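(* Let $(R,\mathfrak m)$ be a Cohen-Macaulay local ring of dimension $d\ge1$ with infinite residue field. Let $I_1,I_2$ be $\mathfrak m$-primary ideals and let $(x_1,\dots,x_d)$ be a minimal reduction of $I_2$ generated by a superficial sequence $x_1,\dots,x_d$ for $I_2$ and $I_1$. Assume $(x_1,\dots,x_d)\subseteq I_1$. Then: (1) $$g_{1,I_1}(I_2)\ \ge\ \sum_{n\ge1}\ell\!\left(\frac{I_1I_2^n+(x_1,\dots,x_d)}{(x_1,\dots,x_d)}\right)-\ell\!\left(\frac R{I_1}\right),$$ and equality holds if and only if $G_{I_1}(I_2)$ is Cohen-Macaulay. (2) $$g_{1,I_1}(I_2)\ \le\ \sum_{n\ge1}\ell\!\left(\frac{I_1I_2^n}{(x_1,\dots,x_d)I_1I_2^{n-1}}\right)-\ell\!\left(\frac R{I_1}\right),$$ and equality holds if and only if $\operatorname{depth}G_{I_1}(I_2)\ge d-1$.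
   Context: $\ell$ denotes length. The integers $g_{j,I_1}(I_2)$, $0\le j\le d$, are defined by $$\ell(R/I_1I_2^n)=\sum_{j=0}^d(-1)^jg_{j,I_1}(I_2)\binom{n+d-j-1}{d-j}\quad\text{for } n\gg0.$$ $G_{I_1}(I_2):=R/I_1\oplus\bigoplus_{n\ge1}I_1I_2^{n-1}/I_1I_2^{n}$, i.e. the associated graded object $\bigoplus_{n\ge0}M_n/M_{n+1}$ of the filtration $M_0=R$, $M_n=I_1I_2^{n-1}$ for $n\ge1$. Since $(x_1,\dots,x_d)\subseteq I_1\cap I_2$, multiplication by $x_i$ maps $M_n/M_{n+1}$ to $M_{n+1}/M_{n+2}$, so $G_{I_1}(I_2)$ is a graded module over $R[X_1,\dots,X_d]$ with $X_i$ acting as this map (the action of the initial form $x_i^\star$). The depth of $G_{I_1}(I_2)$ is the length of a maximal regular sequence on it in the ideal $(X_1,\dots,X_d)$, and it is Cohen-Macaulay when this depth equals $d$. An element $x\in I_2$ is superficial for $I_2$ and $I_1$ if there is a positive integer $r_0$ such that $xR\cap I_1^sI_2^r=xI_1^sI_2^{r-1}$ for all $r\ge r_0$ and all $s\ge0$. A sequence $x_1,\dots,x_d$ in $I_2$ is a superficial sequence for $I_2$ and $I_1$ if for each $i$ the image of $x_i$ in $R/(x_1,\dots,x_{i-1})$ is superficial for the images of $I_2$ and $I_1$. *)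

(* Defs.v *)
From HB Require Import structures.
From mathcomp Require Import all_boot all_order all_algebra.
From mathcomp Require Import all_classical all_reals all_analysis.
(* The notations of mpoly clash with those of the analysis library. *)
From mathcomp Require Import -(notations) mpoly.

Set Implicit Arguments.
Unset Strict Implicit.
Unset Printing Implicit Defensive.

Import Order.TTheory GRing.Theory Num.Theory.

Local Open Scope classical_set_scope.
Local Open Scope ring_scope.

(* Ideals are classical sets, because the boolean [idealr] of ring_quotient is
   always proper, whereas the unit ideal is needed here (it is I^0). *)
Definition is_ideal (R : comNzRingType) (I : set R) : Prop :=
  [/\ I 0, forall a b, I a -> I b -> I (a + b) & forall c a, I a -> I (c * a)].

Definition ideal_gen (R : comNzRingType) (A : set R) : set R :=
  smallest (@is_ideal R) A.

Definition ideal_add (R : comNzRingType) (I J : set R) : set R :=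
  [set a + b | a in I & b in J].

Definition ideal_mul (R : comNzRingType) (I J : set R) : set R :=
  ideal_gen [set a * b | a in I & b in J].

Definition ideal_exp (R : comNzRingType) (I : set R) (n : nat) : set R :=
  iter n (ideal_mul I) setT.

Definition radical (R : comNzRingType) (I : set R) : set R :=
  [set a | exists n, I (a ^+ n)].

Definition prime_ideal (R : comNzRingType) (P : set R) : Prop :=
  [/\ is_ideal P, ~ P 1 & forall a b, P (a * b) -> P a \/ P b].

Definition maximal_ideal (R : comNzRingType) (m : set R) : Prop :=
  [/\ is_ideal m, ~ m 1 &
      forall I, is_ideal I -> ~ I 1 -> m `<=` I -> I = m].

Definition primary_ideal (R : comNzRingType) (Q : set R) : Prop :=
  [/\ is_ideal Q, ~ Q 1 & forall a b, Q (a * b) -> Q a \/ radical Q b].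

Definition primary_to (R : comNzRingType) (m Q : set R) : Prop :=
  primary_ideal Q /\ radical Q = m.

Definition noetherian (R : comNzRingType) : Prop :=
  forall I : set R, is_ideal I -> exists s : seq R, I = ideal_gen [set` s].

Definition local_ring (R : comNzRingType) (m : set R) : Prop :=
  maximal_ideal m /\ forall n : set R, maximal_ideal n -> n = m.

Definition prime_chain (R : comNzRingType) (n : nat) (p : nat -> set R) : Prop :=
  (forall i, (i <= n)%N -> prime_ideal (p i)) /\
  (forall i, (i < n)%N -> p i `<` p i.+1).

Definition krull_dim_is (R : comNzRingType) (d : nat) : Prop :=
  (exists p : nat -> set R, prime_chain d p) /\
  (forall n (p : nat -> set R), prime_chain n p -> (n <= d)%N).

(* R/m as the set of cosets a + m. *)
Definition infinite_residue_field (R : comNzRingType) (m : set R) : Prop :=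
  infinite_set (range (fun a : R => [set a + b | b in m])).

(* The length of the R-module M/N for ideals N `<=` M, with values in
   [0, +oo]: the submodules of M/N are the P/N for ideals P between N and M. *)
Definition ideal_chain (R : comNzRingType) (N M : set R) (n : nat)
    (p : nat -> set R) : Prop :=
  [/\ p 0%N = N, p n = M, forall i, (i <= n)%N -> is_ideal (p i)
    & forall i, (i < n)%N -> p i `<` p i.+1].

Definition len (K : realType) (R : comNzRingType) (M N : set R) : \bar K :=
  ereal_sup [set (n%:R)%:E | n in [set n | exists p, ideal_chain N M n p]].

(* Regular sequences on the A-module K/L, where L `<=` K are additive subgroups
   of V stable under the action of A: f :: s is regular on K/L when f is a
   nonzerodivisor on K/L and s is regular on (K/L)/f(K/L) = K/(L + fK); the
   empty sequence is regular when the module is nonzero. *)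
Fixpoint regular_seq (A : Type) (V : zmodType) (act : A -> V -> V)
    (K L : set V) (s : seq A) : Prop :=
  if s is f :: s' then
    (forall v, K v -> L (act f v) -> L v) /\
    regular_seq act K [set u + act f v | u in L & v in K] s'
  else ~ (K `<=` L).

(* There is a maximal regular sequence on K/L in the ideal a, of length k. *)
Definition depth_is (A : comNzRingType) (V : zmodType) (act : A -> V -> V)
    (a : set A) (K L : set V) (k : nat) : Prop :=
  exists s : seq A,
    [/\ size s = k, forall f, f \in s -> a f, regular_seq act K L s
      & forall f, a f -> ~ regular_seq act K L (rcons s f)].

Definition cohen_macaulay_local (R : comNzRingType) (m : set R) (d : nat) :
    Prop :=
  [/\ noetherian R, local_ring m, krull_dim_is R d
    & depth_is (fun a b : R => a * b) m setT [set 0] d].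

Definition reduction (R : comNzRingType) (J I : set R) : Prop :=
  [/\ is_ideal J, J `<=` I
    & exists n, ideal_exp I n.+1 = ideal_mul J (ideal_exp I n)].

Definition minimal_reduction (R : comNzRingType) (J I : set R) : Prop :=
  reduction J I /\ forall J', reduction J' I -> J' `<=` J -> J' = J.

(* x is superficial for I2 and I1, in this order of the arguments. *)
Definition superficial (R : comNzRingType) (x : R) (I2 I1 : set R) : Prop :=
  I2 x /\
  exists2 r0, (0 < r0)%N & forall r s, (r0 <= r)%N ->
    ideal_gen [set x] `&` ideal_mul (ideal_exp I1 s) (ideal_exp I2 r) =
    ideal_mul (ideal_gen [set x])
              (ideal_mul (ideal_exp I1 s) (ideal_exp I2 r.-1)).

(* The morphism pi : R -> S presents S as the quotient ring R/J. *)
Definition quotient_map (R S : comNzRingType) (pi : {rmorphism R -> S})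
    (J : set R) : Prop :=
  (forall y, exists a, pi a = y) /\ forall a, pi a = 0 <-> J a.

(* R/(x_j : j < i) is unique up to isomorphism over R, so that the choice of
   S and pi does not matter. *)
Definition superficial_seq (R : comNzRingType) (d : nat) (x : 'I_d -> R)
    (I2 I1 : set R) : Prop :=
  (forall i, I2 (x i)) /\
  forall i : 'I_d, exists (S : comNzRingType) (pi : {rmorphism R -> S}),
    quotient_map pi (ideal_gen [set x j | j in [set j : 'I_d | (j < i)%N]]) /\
    superficial (pi (x i)) (pi @` I2) (pi @` I1).

(* g j is g_{j,I1}(I2) for j <= d; the other values of g are irrelevant. *)
Definition hilbert_coeffs (K : realType) (R : comNzRingType) (d : nat)
    (I1 I2 : set R) (g : nat -> int) : Prop :=
  exists n0, forall n, (n0 <= n)%N ->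
    len K setT (ideal_mul I1 (ideal_exp I2 n)) =
    ((\sum_(0 <= j < d.+1)
        (-1) ^+ j * g j * ('C(n + d - j - 1, d - j))%:Z)%:~R)%:E.

(* The filtration M_0 = R, M_n = I1 I2^(n-1). *)
Definition filtration (R : comNzRingType) (I1 I2 : set R) (n : nat) : set R :=
  if n is n'.+1 then ideal_mul I1 (ideal_exp I2 n') else setT.

(* G_{I1}(I2) is the quotient of gr_num = (+)_n M_n T^n by
   gr_den = (+)_n M_(n+1) T^n, both inside R[T]. *)
Definition gr_num (R : comNzRingType) (I1 I2 : set R) : set {poly R} :=
  [set p | forall n, filtration I1 I2 n p`_n].

Definition gr_den (R : comNzRingType) (I1 I2 : set R) : set {poly R} :=
  [set p | forall n, filtration I1 I2 n.+1 p`_n].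

(* The R[X_1, ..., X_d]-module structure of R[T] in which X_i acts as
   multiplication by x_i T; on G_{I1}(I2) this is multiplication by x_i from
   M_n/M_(n+1) to M_(n+1)/M_(n+2). *)
Definition gr_act (R : comNzRingType) (d : nat) (x : 'I_d -> R)
    (f : mpoly.mpoly d R) (p : {poly R}) : {poly R} :=
  mpoly.mmap (@polyC R) (fun i => x i *: 'X) f * p.

Definition var_ideal (R : comNzRingType) (d : nat) : set (mpoly.mpoly d R) :=
  ideal_gen (range (fun i : 'I_d => mpoly.mpolyX R (mpoly.mnm1 i))).

Definition gr_depth_is (R : comNzRingType) (d : nat) (x : 'I_d -> R)
    (I1 I2 : set R) (k : nat) : Prop :=
  depth_is (gr_act x) (@var_ideal R d) (gr_num I1 I2) (gr_den I1 I2) k.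

Definition gr_cohen_macaulay (R : comNzRingType) (d : nat) (x : 'I_d -> R)
    (I1 I2 : set R) : Prop := gr_depth_is x I1 I2 d.

(* Main.v *)
(* Write M_n for the filtration, L_i = (x_1, ..., x_i), J = L_d, e = d - 1.

   Modulo L_e the ring is one-dimensional, and with
   v_n = l((M_(n+1) + L_e) / (x_d M_n + L_e)) a telescoping sum gives
   g_1 = sum_(n >= 1) v_n - l(R/I1), because killing a superficial nonzerodivisor
   differentiates the Hilbert polynomial.  The terms of the two sums satisfy
   l((M_(n+1) + J)/J) <= v_n <= l(M_(n+1)/J M_n), so everything is about equality.

   The right one is an equality for all n iff L_e :&: M_(n+1) <= J M_n for all n, which
   by induction on n is the Valabrega-Valla condition L_e :&: M_(n+1) = L_e M_n.  The left
   one is an equality for all n iff (M_(n+1) + L_e) : x_d = M_n + L_e, which by Sally's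
   machine is the Valabrega-Valla condition for L_d.  That condition for L_k says that
   X_1, ..., X_k is regular on G.

   Two facts compare arbitrary regular sequences with the given elements.  Both come from
   the Koszul complex, whose cohomology vanishes below the length of any regular sequence
   with null-homotopic powers.  For G, the vanishing kills the socle of G/(X_1, ..., X_i),
   while superficiality bounds the degrees in the kernel of X_(i+1), so that a nonzero
   kernel would meet the socle.  For R, the vanishing below d and Nakayama's lemma on the
   modules of cocycles make x_1, ..., x_d regular, without any dimension theory. *)

Require Import Defs.
From mathcomp Require Import all_boot all_order all_algebra.
From mathcomp Require Import all_classical all_reals all_analysis.
From mathcomp Require Import -(notations) mpoly.
From mathcomp Require Import ring zify.

Set Implicit Arguments.
Unset Strict Implicit.
Unset Printing Implicit Defensive.

Import Order.TTheory GRing.Theory Num.Theory.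

Local Open Scope classical_set_scope.
Local Open Scope ring_scope.

(** * The Koszul complex *)

(** Modules are sets in one ambient ring [V] with scalars in a subset [E]. This serves ideals of R
    as well as graded pieces of R[T] over the image of R[X_1, ..., X_d]. *)
Definition submod (V : comNzRingType) (E S : set V) : Prop :=
  [/\ S 0, forall u v, S u -> S v -> S (u - v) & forall e u, E e -> S u -> S (e * u)].

Definition add_mul (V : comNzRingType) (L : set V) (f : V) (K : set V) : set V :=
  [set u + f * v | u in L & v in K].

Section Submod.
Variables (V : comNzRingType) (E : set V).
Implicit Types S K L : set V.

Lemma submodN S u : submod E S -> S u -> S (- u).
Proof. by move=> [S0 SB _] Su; rewrite -[- u]add0r; apply: SB. Qed.

Lemma submodD S u v : submod E S -> S u -> S v -> S (u + v).
Proof.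
by move=> hS Su Sv; rewrite -[v]opprK; case: (hS) => _ + _; apply=> //; apply: submodN.
Qed.

Lemma submod0 : submod E [set 0].
Proof.
by split=> //= [u v -> ->|e u _ ->]; rewrite ?subr0 ?mulr0.
Qed.

Lemma submod_add_mul L f K : submod E L -> submod E K -> submod E (add_mul L f K).
Proof.
move=> [L0 LB LM] [K0 KB KM]; split.
- by exists 0 => //; exists 0 => //; rewrite mulr0 addr0.
- move=> _ _ [u Lu [v Kv <-]] [u' Lu' [v' Kv' <-]].
  by exists (u - u'); [exact: LB|exists (v - v'); [exact: KB|ring]].
- move=> e _ Ee [u Lu [v Kv <-]].
  by exists (e * u); [exact: LM|exists (e * v); [exact: KM|ring]].
Qed.

Lemma sub_add_mul L f K : submod E K -> L `<=` add_mul L f K.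
Proof. by move=> [K0 _ _] u Lu; exists u => //; exists 0 => //; rewrite mulr0 addr0. Qed.

Lemma add_mul_sub L f K : submod E K -> E f -> L `<=` K -> add_mul L f K `<=` K.
Proof.
move=> hK Ef LK _ [u Lu [v Kv <-]]; apply: submodD => //; first exact: LK.
by case: hK => _ _; apply.
Qed.

End Submod.

(* Cochains of the Koszul complex K(ys; V) are functions on bit sequences of
   length [size ys]; a bit sequence stands for the subset of its true positions. *)
Fixpoint koszul (V : comNzRingType) (ys : seq V) (c : seq bool -> V) (bs : seq bool) : V :=
  match ys, bs with
  | y :: ys', true :: bs' =>
      y * c (false :: bs') - koszul ys' (fun b => c (true :: b)) bs'
  | _ :: ys', false :: bs' => koszul ys' (fun b => c (false :: b)) bs'
  | _, _ => 0
  end.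

Definition cell (r i : nat) : set (seq bool) :=
  [set bs | size bs = r /\ count id bs = i].

Section Koszul.
Variables (V : comNzRingType) (E : set V).
Implicit Types (K L S : set V) (ys : seq V) (c : seq bool -> V).

(** Cochains are total functions, and only their values on one cell matter. Those with coefficients
    in K/L are the ones [valued K], taken modulo the ones [valued L]. *)
Definition valued S (r i : nat) c : Prop := forall bs, cell r i bs -> S (c bs).

Lemma koszulB ys c c' bs :
  koszul ys (fun b => c b - c' b) bs = koszul ys c bs - koszul ys c' bs.
Proof.
elim: ys c c' bs => [|y ys IH] c c' [|[] bs] /=; rewrite ?subr0 ?IH //; ring.
Qed.

Lemma koszul0 ys bs : koszul ys (fun=> 0) bs = 0.
Proof. by elim: ys bs => [|y ys IH] [|[] bs] //=; rewrite IH; ring. Qed.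

Lemma koszulM ys f c bs : koszul ys (fun b => f * c b) bs = f * koszul ys c bs.
Proof.
elim: ys c bs => [|y ys IH] c [|[] bs] /=; rewrite ?mulr0 ?IH //; ring.
Qed.

Lemma koszulN ys c bs : koszul ys (fun b => - c b) bs = - koszul ys c bs.
Proof.
rewrite -[RHS]add0r -(koszul0 ys bs) -koszulB.
by congr koszul; apply/funext => b; rewrite sub0r.
Qed.

Lemma koszulD ys c c' bs :
  koszul ys (fun b => c b + c' b) bs = koszul ys c bs + koszul ys c' bs.
Proof.
rewrite -[koszul ys c' bs]opprK -koszulN -koszulB.
by congr koszul; apply/funext => b; rewrite opprK.
Qed.

Lemma koszul_koszul ys c bs : koszul ys (koszul ys c) bs = 0.
Proof.
elim: ys c bs => [|y ys IH] c [|[] bs] //=.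
by rewrite koszulB koszulM IH subr0 subrr.
Qed.

Lemma koszul_cell0 ys c bs : cell (size ys) 0 bs -> koszul ys c bs = 0.
Proof.
elim: ys c bs => [|y ys IH] c [|[] bs] [] //= [sz] ct.
by rewrite IH.
Qed.

Lemma koszul_valued S ys c i : submod E S -> (forall y, y \in ys -> E y) ->
  valued S (size ys) i c -> valued S (size ys) i.+1 (koszul ys c).
Proof.
move=> hS; elim: ys c i => [|y ys IH] c i Ey hc [|[] bs] [] //= [sz].
- move=> ct; case: (hS) => _ SB SM; apply: SB.
    apply: SM; first by apply: Ey; rewrite mem_head.
    by apply: hc; split; rewrite /= ?sz //; lia.
  case: i hc ct => [|i] hc ct; last first.
    apply: (IH _ i) => [z zys|b [bsz bct]|]; first by apply: Ey; rewrite in_cons zys orbT.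
      by apply: hc; split; rewrite /= ?bsz ?bct.
    by split=> //; lia.
  by rewrite koszul_cell0; [case: hS|split=> //; lia].
- move=> ct; apply: (IH _ i) => [z zys|b [bsz bct]|]; first by apply: Ey; rewrite in_cons zys orbT.
    by apply: hc; split; rewrite /= ?bsz ?bct.
  by split=> //; lia.
Qed.

Lemma eq_koszul ys c c' i bs : (forall y, y \in ys -> E y) ->
  valued [set 0] (size ys) i (fun b => c b - c' b) -> cell (size ys) i.+1 bs ->
  koszul ys c bs = koszul ys c' bs.
Proof.
move=> Ey h hbs; apply/eqP; rewrite -subr_eq0 -koszulB; apply/eqP.
exact: (koszul_valued (submod0 E) Ey h).
Qed.

(** The homotopy respects every submodule of coefficients, so a single [s] acts on the complexes of
    all quotients K/L. Linearity allows extension to longer sequences. *)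
Definition null_homotopic ys f : Prop :=
  exists s : (seq bool -> V) -> seq bool -> V,
    [/\ forall c bs, size bs = size ys ->
          f * c bs = koszul ys (s c) bs + s (koszul ys c) bs,
        forall e c c' bs, s (fun b => e * c b - c' b) bs = e * s c bs - s c' bs
      & forall S c i, submod E S ->
          valued S (size ys) i.+1 c -> valued S (size ys) i (s c)].

Lemma null_homotopic0 ys : null_homotopic ys 0.
Proof.
exists (fun _ _ => 0); split=> [c bs _|e c c' bs|S c i [S0 _ _] _ bs _] //.
  by rewrite koszul0 addr0 mul0r.
by ring.
Qed.

Lemma null_homotopicD ys f g :
  null_homotopic ys f -> null_homotopic ys g -> null_homotopic ys (f + g).
Proof.
move=> [s [hs ls vs]] [t [ht lt vt]]; exists (fun c b => s c b + t c b); split.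
- by move=> c bs sz; rewrite mulrDl (hs _ _ sz) (ht _ _ sz) koszulD; ring.
- by move=> e c c' bs; rewrite ls lt; ring.
- move=> S c i hS hc bs hbs; apply: (submodD hS).
    exact: vs hS hc _ hbs.
  exact: vt hS hc _ hbs.
Qed.

Lemma null_homotopicM ys e f : E e -> null_homotopic ys f -> null_homotopic ys (e * f).
Proof.
move=> Ee [s [hs ls vs]]; exists (fun c b => e * s c b); split.
- by move=> c bs sz; rewrite -mulrA (hs _ _ sz) koszulM; ring.
- by move=> a c c' bs; rewrite ls; ring.
- move=> S c i hS hc bs hbs; case: (hS) => _ _; apply => //.
  exact: vs hS hc _ hbs.
Qed.

(** The homotopy is contraction with the basis vector of y. When y is not the head, the contraction
    passes the basis vector of [z], whence the sign on the half containing it. *)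
Lemma null_homotopic_mem ys y : y \in ys -> null_homotopic ys y.
Proof.
elim: ys => [//|z ys IH]; rewrite in_cons => /orP[/eqP->|/IH [s [hs ls vs]]].
  exists (fun c bs => if bs is false :: bs' then c (true :: bs') else 0); split.
  - by move=> c [|[] bs] //= _; rewrite ?koszul0; ring.
  - by move=> e c c' [|[] bs] /=; ring.
  - move=> S c i [S0 _ _] hc [|[] bs] [] //= [sz] ct.
    by apply: hc; split; rewrite /= ?sz //; lia.
exists (fun c bs => if bs is b :: bs' then
                      if b then - s (fun t => c (true :: t)) bs' else s (fun t => c (false :: t)) bs'
                    else 0); split.
- move=> c [|[] bs] //= [sz].
    by rewrite (hs (fun t => c (_ :: t)) _ sz) ls koszulN; ring.
  by rewrite (hs (fun t => c (_ :: t)) _ sz).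
- by move=> e c c' [|[] bs] /=; rewrite ?ls; ring.
- move=> S c i hS hc [|[] bs] [] //= [sz] ct; last first.
    apply: (vs S _ i) => // b [bsz bct]; apply: hc; split; rewrite /= ?bsz //; lia.
  apply: (submodN hS); case: i hc ct => [|i] hc ct; first by lia.
  apply: (vs S _ i) => //; last by split=> //; lia.
  by move=> b [bsz bct]; apply: hc; split; rewrite /= ?bsz //; lia.
Qed.

(* The cohomology of the Koszul complex of K/L vanishes in degrees [< k]. *)
Definition exact_below (k : nat) ys K L : Prop :=
  forall i c, (i < k)%N -> valued K (size ys) i c ->
    valued L (size ys) i.+1 (koszul ys c) ->
    exists2 b, valued K (size ys) i.-1 b
             & valued L (size ys) i (fun t => c t - koszul ys b t).

(** In the long exact sequence of multiplication by f on K/L, the vanishing for K/(L + fK) makes f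
    injective on the cohomology of K/L in degrees up to k, while f^n acts there as zero. *)
Lemma exact_below_lift k ys K L f n : (forall y, y \in ys -> E y) ->
  submod E K -> submod E L -> L `<=` K -> E f ->
  (forall v, K v -> L (f * v) -> L v) -> null_homotopic ys (f ^+ n) ->
  exact_below k ys K (add_mul L f K) -> exact_below k.+1 ys K L.
Proof.
move=> Ey hK hL LK Ef freg [s [hs ls vs]] ex i c ik cK cL.
have [K0 KB KM] := hK; have [L0 LB LM] := hL.
suff [b bK bL] : exists2 b, valued K (size ys) i.-1 b &
    valued L (size ys) i (fun t => f ^+ 0 * c t - koszul ys b t).
  by exists b => // t ht; rewrite -[c t]mul1r -(expr0 f); exact: bL.
have fK j : forall v, K v -> K (f ^+ j * v).
  by elim: j => [|j IH] v Kv; rewrite ?expr0 ?mul1r // exprS -mulrA; apply/KM/IH.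
have fL j : forall v, L v -> L (f ^+ j * v).
  by elim: j => [|j IH] v Kv; rewrite ?expr0 ?mul1r // exprS -mulrA; apply/LM/IH.
(* On a cocycle modulo L the homotopy formula leaves only the differential of [s c], so f^n c is a
   coboundary modulo L. *)
have main : exists2 b, valued K (size ys) i.-1 b &
    valued L (size ys) i (fun t => f ^+ n * c t - koszul ys b t).
  case: i ik cK cL => [|i] ik cK cL.
    exists (fun=> 0) => // t ht; rewrite koszul0 subr0 (hs c); last by case: ht.
    by rewrite koszul_cell0 // add0r; apply: vs cL _ ht.
  exists (s c) => [|t ht]; first exact: vs cK.
  rewrite (hs c); last by case: ht.
  by rewrite addrAC subrr add0r; apply: vs cL _ ht.
(* One factor f is cancelled at a time. If f^(n+1) c = d b modulo L, then b is a cocycle modulo L +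
   fK, so b = d e + f w modulo L and f^n c = d w modulo L. In degree 0 there are no nonzero
   coboundaries and f cancels directly. *)
elim: n main {hs ls vs} => // n IH [b bK bL]; apply: IH.
case: i ik cK cL bK bL => [|i] ik cK cL bK bL.
  exists (fun=> 0) => // t ht; rewrite koszul0 subr0.
  apply: freg; first exact/fK/cK.
  by have := bL t ht; rewrite koszul_cell0 // subr0 exprS mulrA.
rewrite /= in bK *.
have cyc : valued (add_mul L f K) (size ys) i.+1 (koszul ys b).
  move=> t ht; exists (- (f ^+ n.+1 * c t - koszul ys b t)).
    by apply: (submodN hL); exact: bL.
  by exists (f ^+ n * c t); [exact/fK/cK|rewrite exprS; ring].
have [e eK eL] := ex i b ik bK cyc.
have /choice [w hw] : forall t, exists w : V * V, cell (size ys) i t ->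
    [/\ L w.1, K w.2 & w.1 + f * w.2 = b t - koszul ys e t].
  move=> t; have [/eL[u Lu [v Kv h]]|?] := pselect (cell (size ys) i t); last by exists (0, 0).
  by exists (u, v).
exists (fun t => (w t).2) => [t /hw[]//|t ht].
apply: freg.
  apply: KB; first exact/fK/cK.
  apply: (koszul_valued hK Ey _ ht) => t' /hw[]//.
have e1 : koszul ys b t = koszul ys (fun t => (w t).1 + f * (w t).2 + koszul ys e t) t.
  apply: (eq_koszul Ey _ ht) => t' /hw[_ _ ->] /=; ring.
have := bL t ht; rewrite e1 !koszulD koszulM koszul_koszul addr0 exprS => h.
have -> : f * (f ^+ n * c t - koszul ys (fun t0 => (w t0).2) t) =
  (f * f ^+ n * c t - (koszul ys (fun b0 => (w b0).1) t + f * koszul ys (fun b0 => (w b0).2) t))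
  + koszul ys (fun b0 => (w b0).1) t by ring.
apply: (submodD hL) => //.
by apply: (koszul_valued hL Ey _ ht) => t' /hw[].
Qed.

(** This is the connecting map: if d c = h w modulo L, then w is a cocycle one degree higher, hence
    w = d e modulo L, and c - h e is a cocycle modulo L. One degree of vanishing is spent. *)
Lemma exact_below_quotient k ys K L h : (forall y, y \in ys -> E y) ->
  submod E K -> submod E L -> L `<=` K -> E h ->
  (forall v, K v -> L (h * v) -> L v) ->
  exact_below k.+1 ys K L -> exact_below k ys K (add_mul L h K).
Proof.
move=> Ey hK hL LK Eh hreg ex i c ik cK cL.
have [K0 KB KM] := hK; have [L0 LB LM] := hL.
have /choice [w hw] : forall t, exists w : V * V, cell (size ys) i.+1 t ->
    [/\ L w.1, K w.2 & w.1 + h * w.2 = koszul ys c t].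
  move=> t; have [/cL[u Lu [v Kv e]]|?] := pselect (cell (size ys) i.+1 t); last by exists (0, 0).
  by exists (u, v).
have w2K : valued K (size ys) i.+1 (fun t => (w t).2) by move=> t /hw[].
have w1L : valued L (size ys) i.+1 (fun t => (w t).1) by move=> t /hw[].
have cyc : valued L (size ys) i.+2 (koszul ys (fun t => (w t).2)).
  move=> t ht; apply: hreg; first exact: (koszul_valued hK Ey w2K ht).
  have : koszul ys (koszul ys c) t = koszul ys (fun t => (w t).1 + h * (w t).2) t.
    by apply: (eq_koszul Ey _ ht) => t' /hw[_ _ ->] /=; ring.
  rewrite koszul_koszul koszulD koszulM => /eqP; rewrite eq_sym addrC addr_eq0 => /eqP->.
  by apply: (submodN hL); exact: (koszul_valued hL Ey w1L ht).
have [e eK eL] := ex i.+1 _ ik w2K cyc.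
rewrite /= in eK.
have [||g gK gL] := ex i (fun t => c t - h * e t) (ltnW ik).
- by move=> t ht; apply: KB; [exact: cK|apply: KM => //; exact: eK].
- move=> t ht; rewrite koszulB koszulM; have [Lw _ <-] := hw t ht.
  rewrite -addrA -mulrBr; apply: (submodD hL) => //; apply: LM => //; exact: eL.
exists g => // t ht; exists (c t - h * e t - koszul ys g t); first exact: gL.
by exists (e t); [exact: eK|ring].
Qed.

(** An element killed by all of [ys] is a cocycle in degree 0, where nothing nonzero is a
    coboundary. *)
Lemma exact_below_socle k ys K L u : (forall y, y \in ys -> E y) ->
  submod E L -> exact_below k.+1 ys K L -> K u ->
  (forall y, y \in ys -> L (y * u)) -> L u.
Proof.
move=> Ey hL ex Ku Lu; have [L0 LB LM] := hL.
have [||b _ /(_ (nseq (size ys) false))] := ex 0 (fun=> u) isT.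
- by [].
- move=> bs {ex Ey}; elim: ys bs Lu => [|y ys IH] [|[] bs] Lu [] //= [sz] ct.
    rewrite koszul_cell0 ?subr0; first by apply: Lu; rewrite mem_head.
    by split=> //; lia.
  by apply: IH => // z zys; apply: Lu; rewrite in_cons zys orbT.
have hc : cell (size ys) 0 (nseq (size ys) false).
  by split; rewrite ?size_nseq // count_nseq.
by rewrite koszul_cell0 // subr0; apply.
Qed.

Lemma regular_seq_exact_below ys K L fs : (forall y, y \in ys -> E y) ->
  submod E K -> submod E L -> L `<=` K ->
  (forall f, f \in fs -> E f /\ exists n, null_homotopic ys (f ^+ n)) ->
  regular_seq (fun a b : V => a * b) K L fs -> exact_below (size fs) ys K L.
Proof.
move=> Ey hK; elim: fs L => [|f fs IH] L hL LK hfs //= [freg reg].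
have [Ef [n hn]] := hfs f (mem_head _ _).
apply: (exact_below_lift Ey hK hL LK Ef freg hn); apply: IH => //.
- exact: submod_add_mul.
- exact: (add_mul_sub hK).
- by move=> g gfs; apply: hfs; rewrite in_cons gfs orbT.
Qed.

Lemma exact_below_regular_seq ys K L fs j : (forall y, y \in ys -> E y) ->
  submod E K -> submod E L -> L `<=` K -> (forall f, f \in fs -> E f) ->
  regular_seq (fun a b : V => a * b) K L fs -> exact_below (size fs + j) ys K L ->
  exact_below j ys K (foldl (fun L f => add_mul L f K) L fs).
Proof.
move=> Ey hK; elim: fs L => [|f fs IH] L hL LK hfs //= [freg reg] ex.
have Ef := hfs f (mem_head _ _).
apply: IH => //; first exact: submod_add_mul.
- exact: (add_mul_sub hK).
- by move=> g gfs; apply: hfs; rewrite in_cons gfs orbT.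
- exact: (exact_below_quotient Ey hK hL LK Ef freg).
Qed.

End Koszul.

(** * Regular sequences from vanishing of Koszul cohomology *)

Definition comb (V : comNzRingType) (ys : seq V) : set V :=
  foldr (fun y L => add_mul L y setT) [set 0] ys.

Lemma submod_comb (V : comNzRingType) (ys : seq V) : submod setT (comb ys).
Proof.
elim: ys => [|y ys IH] /=; first exact: submod0.
by apply: submod_add_mul.
Qed.

Lemma comb_mem (V : comNzRingType) (ys : seq V) y : y \in ys -> comb ys y.
Proof.
elim: ys => //= z ys IH; rewrite in_cons => /orP[/eqP->|/IH h].
  exists 0; first by case: (submod_comb ys).
  by exists 1 => //; rewrite mulr1 add0r.
by exists y => //; exists 0 => //; rewrite mulr0 addr0.
Qed.

Lemma is_ideal_submod (R : comNzRingType) (I : set R) : is_ideal I <-> submod setT I.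
Proof.
split=> [[I0 ID IM]|hI].
  split=> // [u v Iu Iv|e u _]; last exact: IM.
  by rewrite -mulN1r; apply: ID => //; exact: IM.
split; [by case: hI|by move=> a b; apply: submodD hI|by move=> c a; case: hI => _ _; apply].
Qed.

Lemma ideal_gen_min (R : comNzRingType) (A I : set R) :
  is_ideal I -> A `<=` I -> ideal_gen A `<=` I.
Proof. exact: smallest_sub. Qed.

Lemma ideal_gen_ideal (R : comNzRingType) (A : set R) : is_ideal (ideal_gen A).
Proof.
split=> [I [[]//]|a b ha hb I hI|c a ha I hI].
  by case: (hI) => -[_ ID _] _; apply: ID; [exact: (ha I hI)|exact: (hb I hI)].
by case: (hI) => -[_ _ IM] _; apply: IM; exact: (ha I hI).
Qed.

Lemma sub_ideal_gen (R : comNzRingType) (A : set R) : A `<=` ideal_gen A.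
Proof. exact: sub_gen_smallest. Qed.

(** * Finite generation and Nakayama's lemma for modules of functions *)

Section FunctionModules.
Variables (R : comNzRingType) (T : eqType).
Implicit Types (S B : set (T -> R)).

Definition fsubmod S : Prop :=
  [/\ S (fun=> 0), forall u v, S u -> S v -> S (fun t => u t - v t)
    & forall a u, S u -> S (fun t => a * u t)].

Definition fspan B (gs : seq (T -> R)) : set (T -> R) :=
  foldr (fun g P => [set c | exists a, P (fun t => c t - a * g t)]) B gs.

Lemma fsubmodD S u v : fsubmod S -> S u -> S v -> S (fun t => u t + v t).
Proof.
move=> [S0 SB SM] Su Sv.
have -> : (fun t => u t + v t) = (fun t => u t - (-1) * v t) by apply/funext => t; ring.
by apply: SB => //; apply: SM.
Qed.

Lemma fsubmod_fspan B gs : fsubmod B -> fsubmod (fspan B gs).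
Proof.
move=> hB; elim: gs => //= g gs [S0 SB SM]; split=> [|u v [a ha] [b hb]|b u [a ha]].
- exists 0; suff -> : (fun t => 0 - 0 * g t) = (fun=> 0) by [].
  by apply/funext => t; ring.
- exists (a - b); have -> : (fun t => u t - v t - (a - b) * g t) =
    (fun t => (u t - a * g t) - (v t - b * g t)) by apply/funext => t; ring.
  exact: SB.
- exists (b * a); have -> : (fun t => b * u t - b * a * g t) =
    (fun t => b * (u t - a * g t)) by apply/funext => t; ring.
  exact: SM.
Qed.

Lemma sub_fspan B gs : B `<=` fspan B gs.
Proof.
elim: gs => //= g gs IH c /IH h; exists 0.
by have -> : (fun t => c t - 0 * g t) = c by apply/funext => t; ring.
Qed.

Lemma fspanS B B' gs : B `<=` B' -> fspan B gs `<=` fspan B' gs.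
Proof. by move=> BB; elim: gs => //= g gs IH c [a /IH h]; exists a. Qed.

Definition fall S (gs : seq (T -> R)) : Prop := foldr (fun g P => S g /\ P) True gs.

(** Induction on the coordinates, as for submodules of R^n: the values at t form a finitely
    generated ideal, and the members vanishing at t have one coordinate fewer to treat. *)
Lemma noetherian_functions S (ts : seq T) : noetherian R -> fsubmod S ->
  exists2 gs, fall S gs & S `<=` fspan [set c | {in ts, forall t, c t = 0}] gs.
Proof.
move=> noeR; elim: ts S => [|t ts IH] S hS.
  by exists [::] => // c _ t.
have [S0 SB SM] := hS.
have [|gs gsS hgs] := IH [set c | S c /\ c t = 0].
  split=> //= [u v [Su u0] [Sv v0]|a u [Su u0]].
    by split; [exact: SB|rewrite u0 v0 subr0].
  by split; [exact: SM|rewrite u0 mulr0].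
have hI : is_ideal [set c t | c in S].
  split.
  - by exists (fun=> 0).
  - by move=> _ _ [u Su <-] [v Sv <-]; exists (fun t => u t + v t) => //; exact: fsubmodD.
  - by move=> a _ [u Su <-]; exists (fun t => a * u t) => //; exact: SM.
have [s Is] := noeR _ hI.
have sI a : a \in s -> exists2 c, S c & c t = a.
  move=> as_; have : [set c t | c in S] a by rewrite Is; apply: sub_ideal_gen.
  by move=> [c Sc <-]; exists c.
have Sspan c : S c -> comb s (c t).
  move=> Sc; have : [set c t | c in S] (c t) by exists c.
  rewrite Is; apply: ideal_gen_min; first exact/is_ideal_submod/submod_comb.
  by move=> a /= /comb_mem.
(* Here [hs] lifts generators of the ideal of values; subtracting a combination of them makes c
   vanish at t. *)
have [hs hsS hhs] : exists2 hs, fall S hs &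
    forall c, S c -> comb s (c t) -> fspan [set c | S c /\ c t = 0] hs c.
  elim: s sI {Is Sspan} => [|a s IHs] sI; first by exists [::] => // c Sc /= ->.
  have [|hs hsS hhs] := IHs; first by move=> b bs; apply: sI; rewrite in_cons bs orbT.
  have [w Sw wa] := sI a (mem_head _ _).
  exists (w :: hs) => //= c Sc [u hu [k _ e]]; exists k; apply: hhs.
    by apply: SB => //; exact: SM.
  suff -> : c t - k * w t = u by [].
  by rewrite -e wa; ring.
exists (hs ++ gs).
  elim: hs hsS {hhs} => [_|h hs IHs [Sh /IHs]] //=.
  by elim: gs gsS {hgs} => //= g gs IHg [[Sg _] /IHg].
move=> c Sc; have := hhs c Sc (Sspan c Sc); rewrite /fspan foldr_cat; apply: fspanS => c' [Sc' c0].
have := hgs c' (conj Sc' c0).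
have : fall [set c | S c /\ c t = 0] gs by [].
elim: gs c' c0 {gsS hgs Sc'} => /= [|g gs IHg] c' c0 gS.
  by move=> h t'; rewrite in_cons => /orP[/eqP->|/h].
move=> [a ha]; exists a; apply: IHg => //; last by case: gS.
by case: gS => -[_ ->] _; rewrite c0 mulr0 subr0.
Qed.

(** One generator is eliminated at a time: if g = b + y s and s = a' g modulo the span of the
    others, then (1 - y a') g lies in that span, and 1 - y a' is a unit. *)
Lemma nakayama_functions (y : R) S B gs :
  (forall a, exists w, w * (1 - y * a) = 1) ->
  fsubmod S -> fsubmod B -> fall S gs -> S `<=` fspan B gs ->
  (forall c, S c -> exists2 b, B b & exists2 s, S s & forall t, c t = b t + y * s t) ->
  S `<=` B.
Proof.
move=> yunit hS hB; elim: gs => //= g gs IH [Sg gsS] Sspan SBy.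
apply: IH => // c Sc; have [a ha] := Sspan c Sc.
have hP := fsubmod_fspan gs hB; have [_ _ PM] := hP.
have Pg : fspan B gs g.
  have [b Bb [s Ss e]] := SBy g Sg.
  have [a' ha'] := Sspan s Ss; have [w hw] := yunit a'.
  have -> : g = (fun t => w * (b t + y * (s t - a' * g t))).
    apply/funext => t; rewrite -[LHS]mul1r -hw.
    have -> : b t = g t - y * s t by rewrite e; ring.
    by ring.
  apply/PM/(fsubmodD hP); first exact: (sub_fspan gs Bb).
  by apply: PM.
have -> : c = (fun t => (c t - a * g t) + a * g t) by apply/funext => t; ring.
by apply: fsubmodD => //; exact: PM.
Qed.

End FunctionModules.

(** Otherwise Zorn's lemma puts 1 - y into a maximal ideal, which must be m and so contains 1. *)
Lemma local_ring_unit (R : comNzRingType) (m : set R) (y : R) :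
  local_ring m -> m y -> exists w, w * (1 - y) = 1.
Proof.
move=> [[hm m1 _] muniq] my; apply: contrapT => nounit.
have hI : is_ideal (range (fun w => w * (1 - y))).
  split=> [|_ _ [u _ <-] [v _ <-]|c _ [u _ <-]].
  - by exists 0 => //; rewrite mul0r.
  - by exists (u + v) => //; rewrite mulrDl.
  - by exists (c * u) => //; rewrite mulrA.
pose P := [set A : set R | A = set0 \/ [/\ is_ideal A, ~ A 1 & A (1 - y)]].
have [|A [PA Amax]] := @Zorn_bigcup _ P.
  move=> F FP Ftot; have [[X FX X0]|no] := pselect (exists2 X, F X & X !=set0); last first.
    left; rewrite -subset0 => a [X FX Xa]; apply: no; exists X => //; by exists a.
  have good Y : F Y -> Y !=set0 -> [/\ is_ideal Y, ~ Y 1 & Y (1 - y)].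
    by move=> FY [a Ya]; have [Y0|//] := FP _ FY; rewrite Y0 in Ya.
  right; have [[X00 XD XM] X1 Xy] := good X FX X0.
  split.
  - split; first by exists X.
      move=> a b [Y FY Ya] [Z FZ Zb].
      have [YZ|ZY] := Ftot _ _ FY FZ.
        by exists Z => //; case: (good Z FZ) => [|[_ ZD _] _ _]; [exists b|apply: ZD => //; exact: YZ].
      by exists Y => //; case: (good Y FY) => [|[_ ZD _] _ _]; [exists a|apply: ZD => //; exact: ZY].
    move=> c a [Y FY Ya]; exists Y => //.
    by case: (good Y FY) => [|[_ _ YM] _ _]; [exists a|exact: YM].
  - by move=> [Y FY Y1]; case: (good Y FY) => //; exists 1.
  - by exists X.
have I_P : P (range (fun w => w * (1 - y))).
  right; split=> //; last by exists 1 => //; rewrite mul1r.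
  by move=> [w _ e]; apply: nounit; exists w.
have [A0|[hA A1 Ay]] := PA.
  apply: (Amax _ _ I_P); rewrite A0; split; first by [].
  by move=> h; apply: (h 0); exists 0 => //; rewrite mul0r.
have Amaxl : maximal_ideal A.
  split=> // I hI' I1 AI; apply: contrapT => IA.
  apply: (Amax I); last by right; split=> //; exact: AI.
  split=> // IA'; apply: IA; exact/seteqP.
have AE := muniq _ Amaxl; apply: A1.
case: hA => _ AD _; rewrite -[1](subrK y); apply: AD => //.
by rewrite AE.
Qed.

(** * Removing elements one by one from a Koszul complex over a local ring *)

Section RegularSequence.
Variables (R : comNzRingType).
Implicit Types (ys : seq R).

(** Top-degree coboundaries form the ideal generated by [ys], which turns cohomology into ideal
    membership. *)
Lemma comb_koszul ys v :
  comb ys v <-> exists b, v = koszul ys b (nseq (size ys) true).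
Proof.
elim: ys v => [|y ys IH] v /=.
  by split=> [->|[]//]; exists (fun=> 0).
split=> [[u /IH[b ->] [k _ <-]]|[b ->]].
  exists (fun bs => if bs is true :: t then - b t else k).
  by rewrite koszulN; ring.
exists (- koszul ys (fun t => b (true :: t)) (nseq (size ys) true)).
  by apply: (submodN (submod_comb ys)); apply/IH; eexists.
by exists (b (false :: nseq (size ys) true)) => //; rewrite addrC.
Qed.

(** A relation y u = d b in the top degree for [ys] makes (b, u) a cocycle for [y :: ys] one degree
    below the top; writing it as a coboundary exhibits u in the ideal. *)
Lemma exact_below_head_regular y ys u :
  exact_below (size ys).+1 (y :: ys) setT [set 0] -> comb ys (y * u) -> comb ys u.
Proof.
move=> ex /comb_koszul[b e].
have [||g _ hg] := ex (size ys) (fun bs => if bs is true :: t then b t else u) (leqnn _).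
- by [].
- move=> [|[] bs] [] //= [sz] ct; last by have := count_size id bs; rewrite sz; lia.
  have -> : bs = nseq (size ys) true.
    rewrite -sz; apply/all_pred1P; apply/(all_nthP false) => i ilt.
    have : all id bs by rewrite all_count; apply/eqP; lia.
    by move/(all_nthP false) => /(_ _ ilt) /= ->.
  by apply/eqP; rewrite subr_eq0; apply/eqP; rewrite e; congr koszul; apply/funext.
apply/comb_koszul; exists (fun t => g (false :: t)).
have := hg (false :: nseq (size ys) true).
rewrite /cell /= size_nseq count_nseq /= mul1n add0n => /(_ (conj erefl erefl)) /eqP.
by rewrite subr_eq0 => /eqP.
Qed.

(** A cocycle for [ys], placed on the subsets containing y and extended by zero, becomes a
    coboundary for [y :: ys], so it is y times a cocycle plus a coboundary. Thus y acts surjectively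
    on a finitely generated cohomology module, and Nakayama's lemma kills it. *)
Lemma exact_below_tail (m : set R) y ys : noetherian R -> local_ring m -> m y ->
  exact_below (size ys).+1 (y :: ys) setT [set 0] ->
  exact_below (size ys) ys setT [set (0 : R)].
Proof.
move=> noeR loc my ex i c0 ir _ c00.
pose r := size ys.
(* [S] and [B] are the cocycles and coboundaries of degree i. Values off the cell are arbitrary, so
   functions vanishing on all bit sequences of length r lie in [B]. *)
pose S : set (seq bool -> R) := [set c | valued [set 0] r i.+1 (koszul ys c)].
pose B : set (seq bool -> R) := [set c | exists b, valued [set 0] r i (fun t => c t - koszul ys b t)].
have hS : fsubmod S.
  split=> [t ht|u v Su Sv t ht|a u Su t ht] /=.
  - exact: koszul0.
  - by rewrite koszulB (Su t ht) (Sv t ht) subr0.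
  - by rewrite koszulM (Su t ht) mulr0.
have hB : fsubmod B.
  split=> [|u v [b hb] [b' hb']|a u [b hb]] /=.
  - by exists (fun=> 0) => t ht /=; rewrite koszul0 subr0.
  - exists (fun t => b t - b' t) => t ht /=; rewrite koszulB.
    transitivity ((u t - koszul ys b t) - (v t - koszul ys b' t)); first by ring.
    by rewrite (hb t ht) (hb' t ht) subr0.
  - exists (fun t => a * b t) => t ht /=; rewrite koszulM.
    transitivity (a * (u t - koszul ys b t)); first by ring.
    by rewrite (hb t ht) mulr0.
suff /(_ c0 c00)[b hb] : S `<=` B by exists b.
have [gs gsS Sgs] := noetherian_functions [seq val t | t : r.-tuple bool] noeR hS.
apply: (nakayama_functions (y := y) (gs := gs)) => //.
- move=> a; apply: (local_ring_unit loc); rewrite mulrC.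
  by case: loc => -[[_ _ mM] _ _] _; apply: mM.
- apply: subset_trans Sgs _; apply: fspanS => c hc; exists (fun=> 0) => t [sz _].
  rewrite koszul0 subr0; apply: hc; apply/mapP.
  by exists (Tuple (introT eqP sz)) => //; rewrite mem_enum.
- move=> a Sa.
  have [||g _ hg] := ex i.+1 (fun bs => if bs is true :: t then a t else 0) ir.
  + by [].
  + move=> [|[] bs] [] //= [sz] ct; last exact: koszul0.
    rewrite mulr0 sub0r; apply/eqP; rewrite oppr_eq0; apply/eqP.
    by apply: (Sa bs); split=> //; lia.
  exists (fun t => a t - y * g (false :: t)).
    exists (fun t => - g (true :: t)) => t [sz ct].
    have /= := hg (true :: t); rewrite /cell /= sz ct => /(_ (conj erefl erefl)) e.
    by rewrite koszulN -[RHS]e /=; ring.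
  exists (fun t => g (false :: t)); last by move=> t; ring.
  move=> t [sz ct] /=.
  have /= := hg (false :: t); rewrite /cell /= sz ct => /(_ (conj erefl erefl)).
  by move/eqP; rewrite sub0r oppr_eq0 => /eqP.
Qed.

End RegularSequence.

Fixpoint lin (R : comNzRingType) (y : nat -> R) (k : nat) (M : set R) : set R :=
  if k is k'.+1 then add_mul (lin y k' M) (y k') M else [set 0].

(** Reversed, so that the head is the last element, which is to be regular modulo the tail. *)
Definition down (R : Type) (y : nat -> R) (k : nat) : seq R := rev (mkseq y k).

Lemma downS (R : Type) (y : nat -> R) k : down y k.+1 = y k :: down y k.
Proof. by rewrite /down mkseqS rev_rcons. Qed.

Lemma size_down (R : Type) (y : nat -> R) k : size (down y k) = k.
Proof. by rewrite size_rev size_mkseq. Qed.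

Lemma mem_down (R : eqType) (y : nat -> R) k z :
  reflect (exists2 i, (i < k)%N & z = y i) (z \in down y k).
Proof.
rewrite mem_rev; apply: (iffP mapP) => -[i]; rewrite ?mem_iota.
  by move=> /= ik ->; exists i.
by move=> ik ->; exists i; rewrite ?mem_iota.
Qed.

Lemma comb_down (R : comNzRingType) (y : nat -> R) k : comb (down y k) = lin y k setT.
Proof. by elim: k => // k IH; rewrite downS /= IH. Qed.

Lemma null_homotopic_comb (R : comNzRingType) (ys : seq R) f :
  comb ys f -> null_homotopic setT ys f.
Proof.
suff h zs : {subset zs <= ys} -> forall f, comb zs f -> null_homotopic setT ys f by exact: h.
elim: zs => [_ _ ->|z zs IH sub _ [u hu [v _ <-]]] /=; first exact: null_homotopic0.
apply: null_homotopicD; first by apply: IH => // w wz; apply: sub; rewrite in_cons wz orbT.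
by rewrite mulrC; apply: null_homotopicM => //; apply/null_homotopic_mem/sub/mem_head.
Qed.

(** Some regular sequence of length d lies in m; powers of its members lie in the ideal of the y_i
    and are null-homotopic, so the Koszul cohomology of the y_i vanishes below d. This gives
    regularity of the last element, which [exact_below_tail] then removes. *)
Lemma depth_regular (R : comNzRingType) (m : set R) (d : nat) (y : nat -> R) :
  noetherian R -> local_ring m -> depth_is (fun a b : R => a * b) m setT [set 0] d ->
  (forall i, (i < d)%N -> m (y i)) ->
  (forall f, m f -> exists n, lin y d setT (f ^+ n)) ->
  forall i a, (i < d)%N -> lin y i setT (y i * a) -> lin y i setT a.
Proof.
move=> noeR loc [fs [szfs fsm reg _]] ym mJ.
have : exact_below d (down y d) setT [set (0 : R)].
  rewrite -{1}szfs; apply: (@regular_seq_exact_below _ setT) => //.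
    exact: submod0.
  move=> f ffs; split=> //; have [n hn] := mJ f (fsm f ffs); exists n.
  by apply: null_homotopic_comb; rewrite comb_down.
elim: d ym {mJ szfs} => // d IH ym; rewrite downS => ex i a.
rewrite ltnS leq_eqVlt => /orP[/eqP->|id].
  rewrite -comb_down; apply: exact_below_head_regular; by rewrite size_down.
apply: IH => //; first by move=> j jd; apply: ym; rewrite ltnS ltnW.
rewrite -[X in exact_below X](size_down y d).
by apply: (exact_below_tail (m := m) (y := y d)) => //; [exact: ym|rewrite size_down].
Qed.

(** * Colon conditions for a filtration *)

Section IdealAdd.
Variable R : comNzRingType.
Implicit Types A B : set R.

Lemma submod_ideal_add A B : submod setT A -> submod setT B -> submod setT (ideal_add A B).
Proof.
move=> [A0 AB AM] [B0 BB BM]; split.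
- by exists 0 => //; exists 0 => //; rewrite addr0.
- move=> _ _ [u Au [v Bv <-]] [u' Au' [v' Bv' <-]].
  by exists (u - u'); [exact: AB|exists (v - v'); [exact: BB|ring]].
- move=> e _ Ee [u Au [v Bv <-]].
  by exists (e * u); [exact: AM|exists (e * v); [exact: BM|ring]].
Qed.

Lemma sub_ideal_addl A B : submod setT B -> A `<=` ideal_add A B.
Proof. by move=> [B0 _ _] a Aa; exists a => //; exists 0 => //; rewrite addr0. Qed.

Lemma sub_ideal_addr A B : submod setT A -> B `<=` ideal_add A B.
Proof. by move=> [A0 _ _] a Aa; exists 0 => //; exists a => //; rewrite add0r. Qed.

Lemma ideal_addS A A' B B' : A `<=` A' -> B `<=` B' -> ideal_add A B `<=` ideal_add A' B'.
Proof. by move=> AA BB _ [a /AA ha [b /BB hb <-]]; exists a => //; exists b. Qed.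

Lemma ideal_add_sub A B C : submod setT C -> A `<=` C -> B `<=` C -> ideal_add A B `<=` C.
Proof. by move=> hC AC BC _ [a /AC Ca [b /BC Cb <-]]; exact: submodD hC _ _. Qed.

Lemma submod_lin (y : nat -> R) k A : submod setT A -> submod setT (lin y k A).
Proof.
move=> hA; elim: k => [|k IH] /=; first exact: submod0.
exact: submod_add_mul.
Qed.

Lemma linS (y : nat -> R) k A B : A `<=` B -> lin y k A `<=` lin y k B.
Proof.
by move=> AB; elim: k => //= k IH _ [u /IH hu [v /AB Bv <-]]; exists u => //; exists v.
Qed.

Lemma lin_leq (y : nat -> R) i k A : submod setT A -> (i <= k)%N -> lin y i A `<=` lin y k A.
Proof.
move=> hA; elim: k => [|k IH]; first by rewrite leqn0 => /eqP->.
rewrite leq_eqVlt => /orP[/eqP->//|/IH h] z /h hz.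
exact: (sub_add_mul (y k) hA).
Qed.

End IdealAdd.

Section Filtration.
Variables (R : comNzRingType) (M : nat -> set R) (y : nat -> R) (d : nat).
Hypothesis M_submod : forall n, submod setT (M n).
Hypothesis M0 : M 0 = setT.
Hypothesis M_decr : forall n, M n.+1 `<=` M n.
Hypothesis M_mul : forall i n a, (i < d)%N -> M n a -> M n.+1 (y i * a).

Let L i := lin y i setT.
Hypothesis y_regular : forall i a, (i < d)%N -> L i (y i * a) -> L i a.

(** Injectivity of multiplication by y_i from R/(M_n + L_i) to R/(M_(n+1) + L_i). *)
Definition colon_at i n : Prop := forall a,
  ideal_add (M n.+1) (L i) (y i * a) -> ideal_add (M n) (L i) a.

(** Only the nontrivial inclusion of L_k :&: M_(n+1) = L_k M_n is recorded; for k at most d the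
    other one follows from [lin_M]. *)
Definition valabrega_valla k : Prop := forall n, L k `&` M n.+1 `<=` lin y k (M n).

Lemma M_leq n k : (n <= k)%N -> M k `<=` M n.
Proof.
elim: k => [|k IH]; first by rewrite leqn0 => /eqP->.
rewrite leq_eqVlt => /orP[/eqP->//|/IH h] z /M_decr; exact: h.
Qed.

Lemma L_submod i : submod setT (L i).
Proof. exact: submod_lin. Qed.

Lemma linL i A : lin y i A `<=` L i.
Proof. exact: linS. Qed.

Lemma ML_submod n i : submod setT (ideal_add (M n) (L i)).
Proof. exact: submod_ideal_add (M_submod n) (L_submod i). Qed.

Lemma LM i a b : L i a -> L i (b * a).
Proof. by case: (L_submod i) => _ _; apply. Qed.

Lemma lin_M k n : (k <= d)%N -> lin y k (M n) `<=` M n.+1.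
Proof.
elim: k => [|k IH] kd; first by move=> _ ->; case: (M_submod n.+1).
move=> _ [u hu [v hv <-]]; apply: (submodD (M_submod _)); last exact: M_mul.
by apply: IH hu; exact: ltnW.
Qed.

Lemma mul_lin_M j k n a : (j < d)%N -> lin y k (M n) a -> lin y k (M n.+1) (y j * a).
Proof.
move=> jd; elim: k a => [|k IH] a /=; first by move=> ->; rewrite mulr0.
move=> [u /IH hu [v hv <-]]; exists (y j * u) => //.
by exists (y j * v); [exact: M_mul|ring].
Qed.

Lemma M_mulX j k n a : (j < d)%N -> M n a -> M (n + k) (y j ^+ k * a).
Proof.
move=> jd; elim: k => [|k IH] Ma; first by rewrite addn0 mul1r.
by rewrite addnS exprS -mulrA; apply/M_mul/IH.
Qed.

Lemma ML_mul j i n a : (j < d)%N ->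
  ideal_add (M n) (L i) a -> ideal_add (M n.+1) (L i) (y j * a).
Proof.
move=> jd [u Mu [v Lv <-]]; exists (y j * u); first exact: M_mul.
by exists (y j * v); [exact: LM|ring].
Qed.

(** Write z = u + y_k v with u in L_k M_n. Then y_k v is in L_k, so v is in L_k by regularity, and
    induction on n applies to v. *)
Lemma valabrega_valla_of_lin k : (k < d)%N ->
  (forall n, L k `&` M n.+1 `<=` lin y k.+1 (M n)) -> valabrega_valla k.
Proof.
move=> kd h; elim=> [|n IH] z [Lz Mz]; first by rewrite M0.
have [u hu [v hv e]] := h _ z (conj Lz Mz).
have hL : L k v.
  apply: y_regular => //; have -> : y k * v = z - u by rewrite -e; ring.
  by case: (L_submod k) => _ + _; apply=> //; exact: linL hu.
rewrite -e; apply: (submodD (submod_lin _ _ (M_submod _))) => //.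
apply: mul_lin_M => //; exact: IH.
Qed.

Lemma valabrega_valla_leq i k : (i <= k)%N -> (k <= d)%N ->
  valabrega_valla k -> valabrega_valla i.
Proof.
elim: k => [|k IH]; first by rewrite leqn0 => /eqP->.
rewrite leq_eqVlt => /orP[/eqP->//|ik] kd h; apply: IH => //; first exact: ltnW.
apply: valabrega_valla_of_lin => // n z [Lz Mz]; apply: h; split=> //.
exact: lin_leq (leqnSn k) _ Lz.
Qed.

(** For z = u + y_i a, the colon condition moves a into M_n up to L_i, leaving an element of L_i :&:
    M_(n+1). Conversely, regularity of y_i modulo L_i compares a with the coefficient that the
    intersection condition supplies. *)
Lemma valabrega_valla_colon i : (i < d)%N -> valabrega_valla i ->
  (forall n, colon_at i n) <-> valabrega_valla i.+1.
Proof.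
move=> id hV; have [_ LB _] := L_submod i; split.
  move=> hC n z [[u Lu [a _ e]] Mz].
  have [|b Mb [l Ll e2]] := hC n a.
    by exists z => //; exists (- u); [exact: submodN (L_submod i) _|rewrite -e; ring].
  exists (u + y i * l); last by exists b => //; rewrite -e -e2; ring.
  apply: hV; split.
    by apply: (submodD (L_submod i)) => //; exact: LM.
  have -> : u + y i * l = z - y i * b by rewrite -e -e2; ring.
  by case: (M_submod n.+1) => _ + _; apply=> //; exact: M_mul.
move=> hV1 n a [p Mp [l Ll e]].
have [|u hu [b Mb e2]] := hV1 n p.
  split=> //; exists (- l); first exact: submodN (L_submod i) _.
  by exists a => //; rewrite -e; ring.
exists b => //; exists (a - b); last by ring.
apply: y_regular => //.
have -> : y i * (a - b) = u + l by move: e; rewrite -e2 mulrBr => <-; ring.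
by apply: (submodD (L_submod i)) => //; exact: linL hu.
Qed.

Lemma valabrega_valla0 : valabrega_valla 0.
Proof. by move=> n z []. Qed.

(* Sally's machine: multiply by a high power of [y i.+1], cancel [y i] where it is
   superficial, then cancel the power of [y i.+1] modulo [y i]. *)
Lemma colon_at_lift i n0 : (i.+1 < d)%N -> (forall n, colon_at i.+1 n) ->
  (forall n, (n0 <= n)%N -> colon_at i n) -> forall n, colon_at i n.
Proof.
move=> id hC hS n a ha.
have id' : (i < d)%N by exact: ltnW.
have step j k b : ideal_add (M (k + j)) (L i.+1) (y i.+1 ^+ j * b) ->
    ideal_add (M k) (L i.+1) b.
  elim: j k b => [|j IH] k b; first by rewrite addn0 mul1r.
  rewrite exprS -mulrA addnS => /hC; exact: IH.
(* By [step], b = p + l + y_i c with p in M_(k+1) and l in L_i; the colon condition in degree k + n0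
   passes the hypothesis on b to c, one degree lower. *)
have main k b : ideal_add (M (k + n0)) (L i) (y i.+1 ^+ n0 * b) -> ideal_add (M k) (L i) b.
  elim: k b => [|k IH] b hb.
    by exists b; [rewrite M0|exists 0; [case: (L_submod i)|rewrite addr0]].
  have [|p Mp [_ [l Ll [c _ <-]] e]] := step n0 k.+1 b.
    apply: ideal_addS hb => //; exact: lin_leq (leqnSn i).
  have hc : ideal_add (M k) (L i) c.
    apply: IH; apply: hS; first exact: leq_addl.
    have -> : y i * (y i.+1 ^+ n0 * c) = y i.+1 ^+ n0 * b + (- (y i.+1 ^+ n0 * p)
       + - (y i.+1 ^+ n0 * l)) by rewrite -e; ring.
    apply: (submodD (ML_submod _ _)) => //.
    exists (- (y i.+1 ^+ n0 * p)).
      by rewrite -addSn; apply: (submodN (M_submod _)); exact: (M_mulX n0 id Mp).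
    exists (- (y i.+1 ^+ n0 * l)) => //.
    by apply: (submodN (L_submod _)); exact: LM.
  have -> : b = (p + l) + y i * c by rewrite -e; ring.
  apply: (submodD (ML_submod _ _)); last exact: ML_mul.
  by exists p => //; exists l.
apply: main; apply: hS; first exact: leq_addl.
have -> : y i * (y i.+1 ^+ n0 * a) = y i.+1 ^+ n0 * (y i * a) by ring.
case: ha => p Mp [l Ll <-].
exists (y i.+1 ^+ n0 * p); first by rewrite -addSn; exact: (M_mulX n0 id Mp).
by exists (y i.+1 ^+ n0 * l); [exact: LM|ring].
Qed.

(* The part of degree n of G/(X_1, ..., X_i) is M_n modulo [gr_ideal i n]; at [n = 0] the
   truncated predecessor is harmless since [lin y i (M 0)] lies in [M 1]. *)
Definition gr_ideal i n : set R := ideal_add (M n.+1) (lin y i (M n.-1)).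

Definition gr_regular_at i n : Prop :=
  forall a, M n a -> gr_ideal i n.+1 (y i * a) -> gr_ideal i n a.

Lemma gr_ideal_submod i n : submod setT (gr_ideal i n).
Proof. exact: submod_ideal_add (M_submod _) (submod_lin _ _ (M_submod _)). Qed.

Lemma gr_ideal_M i n : (i <= d)%N -> gr_ideal i n `<=` M n.
Proof.
move=> id; apply: ideal_add_sub => //; case: n => [|n] /=; first by rewrite M0.
exact: lin_M.
Qed.

Lemma gr_ideal_L i n : gr_ideal i n `<=` ideal_add (M n.+1) (L i).
Proof. by apply: ideal_addS => //; exact: linL. Qed.

(** The colon condition puts a into M_(n+1) + L_i; for n positive the Valabrega-Valla condition then
    puts the part in L_i into L_i M_(n-1). *)
Lemma colon_gr_regular i n : valabrega_valla i -> colon_at i n.+1 -> gr_regular_at i n.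
Proof.
move=> hV hC a Ma /gr_ideal_L /hC [p Mp [l Ll e]].
exists p => //; exists l => //.
case: n {hC} Ma Mp => [|n] Ma Mp /=; first by rewrite M0.
apply: hV; split=> //; have -> : l = a - p by rewrite -e; ring.
by case: (M_submod n.+1) => _ + _; apply=> //; exact: M_decr.
Qed.

(** The element is pushed down the filtration: if a = b + l with b in M_j and j < n, then y_i b is
    zero in degree j + 1 of the graded quotient, so b is zero in degree j and moves into M_(j+1) up
    to L_i. *)
Lemma gr_regular_colon i : (i < d)%N -> valabrega_valla i ->
  (forall n, gr_regular_at i n) -> forall n, colon_at i n.
Proof.
move=> id hV hG n a ha.
suff h j : (j <= n)%N -> ideal_add (M j) (L i) a by exact: h.
elim: j => [_|j IH jn].
  by exists a; [rewrite M0|exists 0; [case: (L_submod i)|rewrite addr0]].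
have [b Mb [l Ll e]] := IH (ltnW jn).
have [p Mp [q Lq e2]] : ideal_add (M n.+1) (L i) (y i * b).
  have -> : y i * b = y i * a + - (y i * l) by rewrite -e; ring.
  apply: (submodD (ML_submod _ _)) => //.
  by apply: sub_ideal_addr => //; apply: (submodN (L_submod i)); exact: LM.
have [c Mc [r hr e3]] : gr_ideal i j b.
  apply: hG => //; exists p; first exact: M_leq Mp.
  exists q => //; apply: hV; split=> //.
  have -> : q = y i * b - p by rewrite -e2; ring.
  case: (M_submod j.+1) => _ + _; apply; first exact: M_mul.
  apply: M_leq Mp; exact: ltnW.
exists c => //; exists (r + l); last by rewrite -e -e3; ring.
by apply: (submodD (L_submod i)) => //; exact: linL hr.
Qed.

Lemma valabrega_valla_gr_regular k : (k <= d)%N ->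
  valabrega_valla k <-> forall i n, (i < k)%N -> gr_regular_at i n.
Proof.
elim: k => [|k IH] kd; first by split=> // _; exact: valabrega_valla0.
split=> [hV i n ik|hG].
  have hVi := valabrega_valla_leq (ltnW ik) kd hV.
  have hVi1 := valabrega_valla_leq ik kd hV.
  have id : (i < d)%N by exact: leq_trans ik kd.
  by apply: colon_gr_regular => //; apply: (proj2 (valabrega_valla_colon id hVi) hVi1).
have hVk : valabrega_valla k.
  by apply/IH; [exact: ltnW|move=> i n ik; apply: hG; exact: ltnW].
by apply/valabrega_valla_colon => //; apply: gr_regular_colon => // n; exact: hG.
Qed.

Hypothesis y_superficial : forall i, (i < d)%N ->
  exists n0, forall n, (n0 <= n)%N -> colon_at i n.

(** Sally's machine carries the colon condition from the last index down to all others; the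
    intersection conditions are then built up from k = 0. *)
Lemma valabrega_valla_top : (0 < d)%N ->
  (forall n, colon_at d.-1 n) <-> valabrega_valla d.
Proof.
move=> d0; have dd : (d.-1 < d)%N by rewrite prednK.
split=> [hC|hV]; last first.
  have hV' := valabrega_valla_leq (leq_pred d) (leqnn d) hV.
  by apply: (proj2 (valabrega_valla_colon dd hV')); rewrite prednK.
have hC' j : (j < d)%N -> forall n, colon_at (d.-1 - j) n.
  elim: j => [|j IH] jd; first by rewrite subn0.
  have [|n0 hn0] := @y_superficial (d.-1 - j.+1); first by lia.
  apply: colon_at_lift hn0; first by lia.
  have -> : (d.-1 - j.+1).+1 = (d.-1 - j)%N by lia.
  by apply: IH; lia.
have hC'' i : (i < d)%N -> forall n, colon_at i n.
  move=> id; have := hC' (d.-1 - i)%N.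
  have -> : (d.-1 - (d.-1 - i) = i)%N by lia.
  by apply; lia.
suff h k : (k <= d)%N -> valabrega_valla k by exact: h.
elim: k => [|k IH] kd; first exact: valabrega_valla0.
by apply/valabrega_valla_colon => //; [apply: IH; exact: ltnW|exact: hC''].
Qed.

(* Superficiality bounds the degrees of the kernel of [y i] on gr/(y_0, ..., y_(i-1)),
   so a nonzero kernel contains a nonzero element killed by every [y j]. *)
Lemma socle_gr_regular i : (i < d)%N -> valabrega_valla i ->
  (forall n a, M n a -> (forall j, (j < d)%N -> gr_ideal i n.+1 (y j * a)) -> gr_ideal i n a) ->
  forall n, gr_regular_at i n.
Proof.
move=> id hV soc n; have [n0 hn0] := y_superficial id.
have high k : (n0 <= k)%N -> gr_regular_at i k.
  by move=> hk; apply: colon_gr_regular => //; apply: hn0; exact: leqW.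
(* Descending induction on the degree, with j bounding the distance to [n0]: y_i is regular one
   degree higher, so all multiples y_j' a vanish there and a is in the socle. *)
suff h j k : (n0 <= k + j)%N -> gr_regular_at i k by apply: (h n0); exact: leq_addl.
elim: j k => [|j IH] k; first by rewrite addn0; exact: high.
rewrite addnS -addSn => /IH hk a Ma [p Mp [q hq e]].
apply: soc => // j' jd; apply: hk; first exact: M_mul.
have -> : y i * (y j' * a) = y j' * (y i * a) by ring.
exists (y j' * p); first exact: M_mul.
by exists (y j' * q); [exact: mul_lin_M|rewrite -e; ring].
Qed.

End Filtration.

(** * The associated graded module *)

Section GradedModule.
Variables (R : comNzRingType) (d : nat) (x : 'I_d -> R) (y : nat -> R) (I1 I2 : set R).
Hypothesis xy : forall i : 'I_d, x i = y i.

Let M := filtration I1 I2.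
Hypothesis M_submod : forall n, submod setT (M n).
Hypothesis M_decr : forall n, M n.+1 `<=` M n.
Hypothesis M_mul : forall i n a, (i < d)%N -> M n a -> M n.+1 (y i * a).
Hypothesis y_regular : forall i a, (i < d)%N -> lin y i setT (y i * a) -> lin y i setT a.
Hypothesis M1_proper : ~ M 1 1.
Hypothesis y_superficial : forall i, (i < d)%N ->
  exists n0, forall n, (n0 <= n)%N -> colon_at M y i n.

Let M0 : M 0 = setT := erefl.

(** [gr_act] is multiplication by [phi f], so G becomes a quotient of submodules of R[T] over the
    subring [E], to which the Koszul lemmas apply. *)
Let phi : mpoly.mpoly d R -> {poly R} := mpoly.mmap (@polyC R) (fun i => x i *: 'X).
Let E : set {poly R} := range phi.
Let Y (i : nat) : {poly R} := y i *: 'X.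

Definition graded (N : nat -> set R) : set {poly R} := [set p | forall n, N n p`_n].

Let K := graded M.
Let Q i := graded (gr_ideal M y i).

Lemma coefYM i (p : {poly R}) n : (Y i * p)`_n = if n is k.+1 then y i * p`_k else 0.
Proof. by rewrite -scalerAl coefZ coefXM; case: n => [|n] //=; rewrite mulr0. Qed.

Lemma phi_var (i : 'I_d) : phi (mpoly.mpolyX R (mpoly.mnm1 i)) = Y i.
Proof. by rewrite /phi mpoly.mmapX mpoly.mmap1U xy. Qed.

Lemma submod_graded N : (forall n, submod setT (N n)) ->
  (forall i n a, (i < d)%N -> N n a -> N n.+1 (y i * a)) -> submod E (graded N).
Proof.
move=> hN Ny.
have g0 : graded N 0 by move=> n; rewrite coef0; case: (hN n).
have gD p q : graded N p -> graded N q -> graded N (p + q).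
  by move=> hp hq n; rewrite coefD; apply: (submodD (hN n)).
split=> // [p q hp hq n|_ p [f _ <-]].
  by rewrite coefB; case: (hN n) => _ + _; apply.
(* Polynomials are reduced to monomials by sums, and monomials to single variables by products. *)
rewrite /phi /mpoly.mmap; move: p.
apply: (big_ind (fun q => forall p, graded N p -> graded N (q * p))).
- by move=> p _; rewrite mul0r.
- by move=> q q' hq hq' p hp; rewrite mulrDl; apply: gD; [exact: hq|exact: hq'].
move=> mm _ p hp; rewrite -mulrA => n; rewrite coefCM.
case: (hN n) => _ _; apply => //; move: p hp n; rewrite /mpoly.mmap1.
apply: (big_ind (fun q => forall p, graded N p -> graded N (q * p))).
- by move=> p hp; rewrite mul1r.
- by move=> q q' hq hq' p hp; rewrite -mulrA; apply/hq/hq'.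
move=> i _; rewrite xy; set e := (X in _ ^+ X); elim: e => [|k IH] p hp; first by rewrite expr0 mul1r.
rewrite exprS -mulrA => -[|n]; rewrite coefYM; first by case: (hN 0).
by apply: Ny => //; exact: IH.
Qed.

Lemma submodK : submod E K.
Proof. exact: submod_graded. Qed.

Lemma gr_ideal_mul i j n a : (j < d)%N -> gr_ideal M y i n a -> gr_ideal M y i n.+1 (y j * a).
Proof.
move=> jd [p Mp [q hq <-]]; exists (y j * p); first exact: M_mul.
exists (y j * q); last by ring.
case: n hq {Mp} => [|n] hq /=; last exact: (mul_lin_M M_mul).
by case: (submod_lin y i (M_submod 0)) => _ _; apply.
Qed.

Lemma submodQ i : submod E (Q i).
Proof.
apply: submod_graded => [n|j n a]; first exact: gr_ideal_submod.
exact: gr_ideal_mul.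
Qed.

Lemma subQK i : (i <= d)%N -> Q i `<=` K.
Proof. by move=> id p hp n; apply: (gr_ideal_M M_submod M0 M_decr M_mul id); exact: hp. Qed.

Lemma Q0 : Q 0 = gr_den I1 I2.
Proof.
apply/seteqP; split=> p hp n; have := hp n.
  by move=> [a Ma [_ -> <-]]; rewrite addr0.
by exists p`_n => //; exists 0 => //; rewrite addr0.
Qed.

(** Checked degree by degree. In degree 0 the product with [Y i] contributes nothing, and the extra
    term y_i M_0 is absorbed by M_1. *)
Lemma QS i : (i < d)%N -> add_mul (Q i) (Y i) K = Q i.+1.
Proof.
move=> id; apply/seteqP; split=> [_ [u hu [v hv <-]] n|p hp].
  rewrite coefD coefYM; have [a Ma [b hb e]] := hu n.
  exists a => //; case: n hb e {Ma} => [|n] hb <-; last first.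
    by exists (b + y i * v`_n); [exists b => //; exists v`_n|ring].
  by exists b; [exact: sub_add_mul|ring].
(* Each coefficient is decomposed separately; zeros from the size of p on keep both parts
   polynomials. *)
have /choice[w hw] : forall n, exists w : R * R,
    [/\ gr_ideal M y i n w.1, M n.-1 w.2,
        p`_n = w.1 + (if n is 0 then 0 else y i * w.2) & (size p <= n)%N -> w = (0, 0)].
  move=> n; have [sp|sp] := leqP (size p) n.
    exists (0, 0); split=> //=; first by case: (gr_ideal_submod y M_submod i n).
      by case: (M_submod n.-1).
    by rewrite nth_default //; case: n {sp}; rewrite ?mulr0 addr0.
  have [a Ma [_ [b hb [c hc <-]] e]] := hp n.
  case: n Ma hb hc e sp => [|n] Ma hb hc e sp.
    exists (p`_0, 0); split=> //=; last by rewrite addr0.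
    exists p`_0; last by exists 0; [case: (submod_lin y i (M_submod 0))|rewrite addr0].
    rewrite -e; apply: (submodD (M_submod 1)) => //.
    by apply: (lin_M M_submod M_mul id); exists b => //; exists c.
  exists (a + b, c); split=> //=; last by rewrite -e; ring.
  by exists a => //; exists b.
have w0 n : (size p <= n)%N -> w n = (0, 0) by case: (hw n).
exists (\poly_(n < size p) (w n).1).
  move=> n; rewrite coef_poly; case: ltnP => sp; first by case: (hw n).
  by case: (gr_ideal_submod y M_submod i n).
exists (\poly_(n < size p) (w n.+1).2).
  move=> n; rewrite coef_poly; case: ltnP => sp; first by case: (hw n.+1).
  by case: (M_submod n).
apply/polyP => n; have [_ _ -> _] := hw n; rewrite coefD coefYM coef_poly.
congr (_ + _); first by case: ltnP => // /w0 ->.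
case: n => // n; rewrite coef_poly; case: ltnP => // sp.
by rewrite w0 //; exact: leqW.
Qed.

Lemma regular_Y i : (forall v, K v -> Q i (Y i * v) -> Q i v) <->
  (forall n, gr_regular_at M y i n).
Proof.
split=> [h n a Ma hQ|h v hv hQ n]; last first.
  by apply: h; [exact: hv|have := hQ n.+1; rewrite coefYM].
have : Q i (a *: 'X^n).
  apply: h => k.
    rewrite coefZ coefXn; case: eqP => [->|_]; first by rewrite mulr1.
    by rewrite mulr0; case: (M_submod k).
  rewrite coefYM; case: k => [|k]; first by case: (gr_ideal_submod y M_submod i 0).
  rewrite coefZ coefXn; case: eqP => [->|_]; first by rewrite mulr1.
  by rewrite !mulr0; case: (gr_ideal_submod y M_submod i k.+1).
by move=> /(_ n); rewrite coefZ coefXn eqxx mulr1.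
Qed.

Lemma foldl_Y c i : (i + c <= d)%N ->
  foldl (fun L f => add_mul L f K) (Q i) [seq Y j | j <- iota i c] = Q (i + c).
Proof.
elim: c i => [|c IH] i /= icd; first by rewrite addn0.
by rewrite QS ?IH ?addSnnS //; lia.
Qed.

Lemma one_notin_Q i : (i <= d)%N -> ~ (K `<=` Q i).
Proof.
move=> id /(_ 1); have h1 : K 1.
  move=> n; rewrite coef1; case: n => [|n] //=.
  by case: (M_submod n.+1).
move=> /(_ h1) /(_ 0); rewrite coef1 eqxx mulr1n => -[a Ma [b hb e]]; apply: M1_proper.
by rewrite -e; apply: (submodD (M_submod 1)) => //; exact: (lin_M M_submod M_mul id).
Qed.

Lemma regular_seq_Y c i : (i + c <= d)%N ->
  regular_seq (fun a b : {poly R} => a * b) K (Q i) [seq Y j | j <- iota i c] <->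
  (forall j n, (i <= j < i + c)%N -> gr_regular_at M y j n).
Proof.
elim: c i => [|c IH] i icd.
  rewrite addn0; split=> [_ j n|_]; first by lia.
  by apply: one_notin_Q; lia.
have id : (i < d)%N by lia.
rewrite /= -/(add_mul (Q i) (Y i) K) QS // IH; last by lia.
rewrite regular_Y; split=> [[h1 h2] j n|h]; last first.
  by split=> [n|j n ij]; apply: h; lia.
rewrite leq_eqVlt => /andP[/orP[/eqP<-//|ij] jic]; apply: h2; lia.
Qed.

Lemma regular_seq_gr_act L s :
  regular_seq (gr_act x) K L s <->
  regular_seq (fun a b : {poly R} => a * b) K L (map phi s).
Proof.
elim: s L => [|f s IH] L //=.
by split=> -[h1 h2]; split=> //; apply/IH.
Qed.

Let ys := [seq Y j | j <- iota 0 d].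

Lemma mem_ys f : reflect (exists2 j, (j < d)%N & f = Y j) (f \in ys).
Proof.
by apply: (iffP mapP) => -[j]; rewrite ?mem_iota => jd ->; exists j; rewrite ?mem_iota.
Qed.

Lemma ysE f : f \in ys -> E f.
Proof.
move=> /mem_ys[j jd ->]; exists (mpoly.mpolyX R (mpoly.mnm1 (Ordinal jd))) => //.
exact: phi_var.
Qed.

Lemma var_ideal_ind (P : set {poly R}) : P 0 -> (forall f g, P f -> P g -> P (f + g)) ->
  (forall e f, E e -> P f -> P (e * f)) -> (forall j, (j < d)%N -> P (Y j)) ->
  forall f, @var_ideal R d f -> P (phi f).
Proof.
move=> P0 PD PM PY; apply: (ideal_gen_min (I := [set f | P (phi f)])) => [|_ [i _ <-]] /=;
  last first.
  by rewrite phi_var; exact: PY.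
by split=> /= [|f g|c f]; rewrite /phi ?rmorph0 ?rmorphD ?rmorphM //;
  [exact: PD|move=> h; apply: PM => //; exists c].
Qed.

(** The regular sequence forces the Koszul cohomology of G on the variables to vanish below k.
    Dividing by i < k regular variables leaves vanishing in degree 0, so the quotient has no socle
    and the next variable is regular. *)
Lemma gr_depth_valabrega_valla k i : gr_depth_is x I1 I2 k -> (i <= k)%N -> (i <= d)%N ->
  valabrega_valla M y i.
Proof.
move=> [s [<- sv reg _]] ik id.
have hV := valabrega_valla_gr_regular M_submod M0 M_decr M_mul y_regular.
have ex : exact_below (size s) ys K (Q 0).
  rewrite -(size_map phi); apply: (regular_seq_exact_below (E := E) ysE submodK).
  - exact: submodQ.
  - exact: subQK.
  - move=> _ /mapP[f /sv vf ->]; split; first by exists f.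
    (* Elements of the variable ideal are combinations of the variables, so their first powers are
       already null-homotopic. *)
    exists 1%N; rewrite expr1; apply: (var_ideal_ind _ _ _ _ vf).
    + exact: null_homotopic0.
    + exact: null_homotopicD.
    + exact: null_homotopicM.
    + by move=> j jd; apply: null_homotopic_mem; apply/mem_ys; exists j.
  - by rewrite Q0; apply/regular_seq_gr_act.
elim: i ik id => [|i IH] ik id; first exact: valabrega_valla0.
have hVi : valabrega_valla M y i by apply: IH; exact: ltnW.
have hG := (hV i (ltnW id)).1 hVi.
have exi : exact_below (size s - i) ys K (Q i).
  rewrite -[i in Q i]add0n -foldl_Y ?add0n; last exact: ltnW.
  apply: (exact_below_regular_seq (E := E) ysE submodK).
  - exact: submodQ.
  - exact: subQK.
  - by move=> f /mapP[j]; rewrite mem_iota => jd ->; apply/ysE/mem_ys; exists j => //; lia.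
  - by apply/regular_seq_Y; [lia|move=> j n ji; apply: hG; lia].
  - by rewrite size_map size_iota subnKC //; exact: ltnW.
apply/hV => // j n; rewrite ltnS leq_eqVlt => /orP[/eqP->|ji]; last exact: hG.
apply: (socle_gr_regular M_submod M0 M_decr M_mul y_superficial id hVi) => {}n a Ma soc.
(* Since i < k, at least degree 0 is left. *)
rewrite -(subnSK ik) in exi.
have /(_ n) : Q i (a *: 'X^n).
  apply: (exact_below_socle (E := E) ysE (submodQ i) exi).
    move=> k'; rewrite coefZ coefXn; case: eqP => [->|_]; first by rewrite mulr1.
    by rewrite mulr0; case: (M_submod k').
  move=> _ /mem_ys[j' jd ->] [|k']; rewrite coefYM.
    by case: (gr_ideal_submod y M_submod i 0).
  rewrite coefZ coefXn; case: eqP => [->|_]; first by rewrite mulr1; exact: soc.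
  by rewrite !mulr0; case: (gr_ideal_submod y M_submod i k'.+1).
by rewrite coefZ coefXn eqxx mulr1.
Qed.

Lemma regular_seq_rcons (A : Type) (V : comNzRingType) (act : A -> V -> V)
    (K' L : set V) s f v :
  let L' := foldl (fun L f => [set u + act f v | u in L & v in K']) L s in
  regular_seq act K' L (rcons s f) -> K' v -> L' (act f v) -> L' v.
Proof.
elim: s L => [|g s IH] L /= [h1 h2]; first exact: h1.
exact: IH.
Qed.

(** The first k variables form a regular sequence; a T^n is nonzero modulo them and killed by the
    whole variable ideal, so nothing can be appended. *)
Lemma gr_depth_of_socle k n a : (k <= d)%N -> valabrega_valla M y k -> M n a ->
  (forall j, (j < d)%N -> gr_ideal M y k n.+1 (y j * a)) -> ~ gr_ideal M y k n a ->
  gr_depth_is x I1 I2 k.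
Proof.
move=> kd hV Ma soc na.
pose s := [seq mpoly.mpolyX R (mpoly.mnm1 i) | i <- take k (enum 'I_d)].
have sE : map phi s = [seq Y j | j <- iota 0 k].
  rewrite -map_comp (eq_map phi_var) (map_comp Y val) map_take val_enum_ord.
  by rewrite take_iota (minn_idPl kd).
exists s; split.
- by rewrite size_map size_take size_enum_ord; case: ltngtP kd.
- by move=> f /mapP[i _ ->]; apply: sub_ideal_gen; exists i.
- apply/regular_seq_gr_act; rewrite sE -Q0; apply/regular_seq_Y => // j n' jk.
  by apply: (valabrega_valla_gr_regular M_submod M0 M_decr M_mul y_regular kd).1.
move=> f fv /regular_seq_gr_act; rewrite map_rcons sE -Q0 => reg.
have := regular_seq_rcons (v := a *: 'X^n) reg.
rewrite -/(add_mul _ _ _) => h.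
apply: na; suff /(_ n) : Q k (a *: 'X^n) by rewrite coefZ coefXn eqxx mulr1.
move: h; rewrite (foldl_Y (i := 0)) //; apply.
  move=> k'; rewrite coefZ coefXn; case: eqP => [->|_]; first by rewrite mulr1.
  by rewrite mulr0; case: (M_submod k').
have [Q00 _ QM] := submodQ k.
apply: (var_ideal_ind (P := [set f | Q k (f * (a *: 'X^n))]) _ _ _ _ fv) => /=.
- by rewrite mul0r.
- by move=> g g' hg hg'; rewrite mulrDl; apply: submodD (submodQ k) _ _.
- by move=> e g Ee hg; rewrite -mulrA; apply: QM.
move=> j jd [|k']; rewrite coefYM; first by case: (gr_ideal_submod y M_submod k 0).
rewrite coefZ coefXn; case: eqP => [->|_]; first by rewrite mulr1; exact: soc.
by rewrite !mulr0; case: (gr_ideal_submod y M_submod k k'.+1).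
Qed.

Lemma gr_cohen_macaulayP : gr_cohen_macaulay x I1 I2 <-> valabrega_valla M y d.
Proof.
split=> [h|hV]; first exact: gr_depth_valabrega_valla h _ _.
(* Modulo all variables, 1 is a socle element in degree 0, nonzero because M_1 is proper. *)
apply: (@gr_depth_of_socle d 0 1) => // [j jd|[a Ma [b hb e]]]; last first.
  apply: M1_proper; rewrite -e; apply: (submodD (M_submod 1)) => //.
  exact: (lin_M M_submod M_mul (leqnn d)).
exists 0; first by case: (M_submod 2).
exists (y j); last by rewrite add0r mulr1.
rewrite /= -comb_down; apply: comb_mem; apply/mem_down; by exists j.
Qed.

(** If the condition for d fails, the quotient by the first d - 1 variables has a nonzero socle,
    since otherwise the last variable would be regular; these variables are then a maximal regular
    sequence. *)
Lemma gr_depth_predP : (0 < d)%N ->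
  (exists2 k, gr_depth_is x I1 I2 k & (d.-1 <= k)%N) <-> valabrega_valla M y d.-1.
Proof.
move=> d0; split=> [[k hk dk]|hV]; first exact: gr_depth_valabrega_valla hk dk (leq_pred d).
have [hd|nd] := pselect (valabrega_valla M y d).
  by exists d; [apply/gr_cohen_macaulayP|exact: leq_pred].
exists d.-1 => //.
have dd : (d.-1 < d)%N by rewrite prednK.
have [[n [a [Ma soc na]]]|no] := pselect (exists n a, [/\ M n a,
    (forall j, (j < d)%N -> gr_ideal M y d.-1 n.+1 (y j * a)) & ~ gr_ideal M y d.-1 n a]).
  exact: gr_depth_of_socle (leq_pred d) hV Ma soc na.
exfalso; apply: nd.
have hP := valabrega_valla_gr_regular M_submod M0 M_decr M_mul y_regular.
apply/hP => // i n id.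
have [->|ne] := eqVneq i d.-1; last by apply: (hP _ (leq_pred d)).1 => //; lia.
apply: (socle_gr_regular M_submod M0 M_decr M_mul y_superficial dd hV) => {}n a Ma soc.
by apply: contrapT => na; apply: no; exists n, a.
Qed.

End GradedModule.

(** * Length *)

Section Length.
Variable R : comNzRingType.
Implicit Types A B N M P Q L : set R.

Lemma ideal_chain_leq N M n p i j : ideal_chain N M n p -> (i <= j <= n)%N -> p i `<=` p j.
Proof.
move=> [_ _ _ h]; elim: j => [|j IH]; first by rewrite leqn0 => /andP[/eqP-> _].
rewrite leq_eqVlt => /andP[/orP[/eqP->|ij] jn] z hz; first by [].
have [jj _] := h j jn; have ijn : (i <= j <= n)%N by lia.
exact: jj _ (IH ijn _ hz).
Qed.

Lemma ideal_chain_between N M n p i : ideal_chain N M n p -> (i <= n)%N ->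
  [/\ submod setT (p i), N `<=` p i & p i `<=` M].
Proof.
move=> ch; have [p0 pn pI _] := ch => ile; split; first exact/is_ideal_submod/pI.
  by rewrite -p0; apply: (ideal_chain_leq ch); rewrite ile.
by rewrite -pn; apply: (ideal_chain_leq ch); rewrite ile leqnn.
Qed.

Lemma ideal_chain_rcons N P M n p : ideal_chain N P n p -> submod setT M -> P `<` M ->
  ideal_chain N M n.+1 (fun i => if (i <= n)%N then p i else M).
Proof.
move=> [p0 pn pI pS] hM PM; split=> [||i _|i].
- by rewrite leq0n.
- by rewrite ltnn.
- by case: ifP => [/pI//|_]; exact/is_ideal_submod.
- rewrite ltnS => ile; rewrite ile; case: ifP => [/pS//|/negbT]; rewrite -ltnNge ltnS => nle.
  by have -> : i = n; [lia|rewrite pn].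
Qed.

Lemma ideal_chain0 N : submod setT N -> ideal_chain N N 0 (fun=> N).
Proof. by move=> hN; split=> // i _; exact/is_ideal_submod. Qed.

Lemma ideal_chain_cat N P M n k p q : ideal_chain N P n p -> ideal_chain P M k q ->
  exists r, ideal_chain N M (n + k) r.
Proof.
elim: k M q => [|k IH] M q hp hq.
  by have [q0 qn _ _] := hq; rewrite addn0; exists p; rewrite -qn q0.
have [q0 qn qI qS] := hq; have [|r hr] := IH (q k) q hp.
  by split=> // i ik; [apply: qI; exact: leqW|apply: qS; exact: ltnW].
exists (fun i => if (i <= n + k)%N then r i else M); rewrite addnS; apply: (ideal_chain_rcons hr).
  by rewrite -qn; exact/is_ideal_submod/qI.
by rewrite -qn; apply: qS.
Qed.

Definition has_length N M (n : nat) : Prop :=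
  (exists p, ideal_chain N M n p) /\ forall k p, ideal_chain N M k p -> (k <= n)%N.

Lemma has_length_uniq N M n k : has_length N M n -> has_length N M k -> n = k.
Proof.
move=> [[p hp] hn] [[q hq] hk]; apply/eqP; rewrite eqn_leq.
by rewrite (hk _ _ hp) (hn _ _ hq).
Qed.

Lemma has_length_bounded N M b : submod setT N -> submod setT M -> N `<=` M ->
  (forall k p, ideal_chain N M k p -> (k <= b)%N) -> exists2 n, has_length N M n & (n <= b)%N.
Proof.
move=> hN hM NM hb.
have ex0 : exists n, `[< exists p, ideal_chain N M n p >].
  have [<-|ne] := pselect (N = M).
    by exists 0%N; apply/asboolP; eexists; exact: ideal_chain0.
  exists 1%N; apply/asboolP; eexists; apply: (ideal_chain_rcons (ideal_chain0 hN)) => //.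
  by split=> // MN; apply: ne; exact/seteqP.
have ub n : `[< exists p, ideal_chain N M n p >] -> (n <= b)%N.
  by move=> /asboolP[p /hb].
have [n /asboolP hn nmax] := ex_maxnP ex0 ub.
exists n; last by case: hn => p /hb.
by split=> // k p hp; apply: nmax; apply/asboolP; exists p.
Qed.

Lemma has_length_refl N : submod setT N -> has_length N N 0.
Proof.
move=> hN; split; first by eexists; exact: ideal_chain0.
move=> [//|k] p ch; have [p0 pn _ /(_ 0%N isT)[_ no]] := ch; case: no.
by rewrite p0 -pn; apply: (ideal_chain_leq ch); rewrite leqnn.
Qed.

Lemma has_length_eq0 N M : submod setT N -> submod setT M -> N `<=` M ->
  has_length N M 0 -> N = M.
Proof.
by move=> hN hM NM [[p [<- <-]]].
Qed.

(** Treats A = B and strict inclusion at once, so that strict growth can be counted. *)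
Lemma ideal_chain_extend N A B n : (exists p, ideal_chain N A n p) -> submod setT B ->
  A `<=` B -> exists k, [/\ (n <= k)%N, exists p, ideal_chain N B k p & B `<=` A \/ (n < k)%N].
Proof.
move=> [p hp] hB AB; have [BA|nBA] := pselect (B `<=` A).
  by exists n; split=> //; [exists p; have -> : B = A by exact/seteqP|left].
exists n.+1; split=> //; last by right.
by eexists; apply: ideal_chain_rcons hp hB _.
Qed.

Lemma submodI A B : submod setT A -> submod setT B -> submod setT (A `&` B).
Proof.
move=> [x0 xB xM] [y0 yB yM]; split=> // [u v [? ?] [? ?]|e u _ [? ?]].
  by split; [exact: xB|exact: yB].
by split; [exact: xM|exact: yM].
Qed.

(** A chain from N to M is intersected with P and added to P. By the modular law each strict
    inclusion stays strict in at least one of the two chains, so its length is at most a + b. *)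
Lemma has_length_add N P M a b : submod setT N -> submod setT P -> submod setT M ->
  N `<=` P -> P `<=` M -> has_length N P a -> has_length P M b -> has_length N M (a + b).
Proof.
move=> hN hP hM NP PM [[p hp] pmax] [[q hq] qmax]; split.
  exact: ideal_chain_cat hp hq.
move=> k r ch; have [r0 rk rI rS] := ch.
suff h i : (i <= k)%N -> exists a' b', [/\ (i <= a' + b')%N,
    exists p, ideal_chain N (r i `&` P) a' p & exists q, ideal_chain P (ideal_add (r i) P) b' q].
  have [a' [b' [kab [p' hp'] [q' hq']]]] := h k (leqnn k).
  apply: (leq_trans kab); apply: leq_add.
    by apply: (pmax _ p'); rewrite rk (setIidr PM) in hp'.
  apply: (qmax _ q'); have <- // : ideal_add (r k) P = M.
  rewrite rk; apply/seteqP; split; first exact: ideal_add_sub.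
  exact: sub_ideal_addl.
elim: i => [_|i IH ik].
  exists 0%N, 0%N; split=> //.
    by rewrite r0 (setIidl NP); eexists; exact: ideal_chain0.
  have -> : ideal_add (r 0%N) P = P.
    rewrite r0; apply/seteqP; split; first exact: ideal_add_sub.
    exact: sub_ideal_addr.
  by eexists; exact: ideal_chain0.
have [a' [b' [iab hp' hq']]] := IH (ltnW ik).
have [hi _ _] := ideal_chain_between ch (ltnW ik).
have [hi1 _ _] := ideal_chain_between ch ik.
have [sub nsub] := rS i ik.
have hA : submod setT (ideal_add (r i.+1) P) by exact: submod_ideal_add.
have subI : r i `&` P `<=` r i.+1 `&` P by exact: setSI.
have subA : ideal_add (r i) P `<=` ideal_add (r i.+1) P by exact: ideal_addS.
have [a2 [aa2 ha2 sa]] := ideal_chain_extend hp' (submodI hi1 hP) subI.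
have [b2 [bb2 hb2 sb]] := ideal_chain_extend hq' hA subA.
exists a2, b2; split=> //.
suff : (a' < a2)%N \/ (b' < b2)%N by case=> ?; lia.
case: sa => [eI|]; last by left.
case: sb => [eA|]; last by right.
(* the modular law *)
case: nsub => z hz.
have [u hu [v hv e]] : ideal_add (r i) P z by apply: eA; exact: sub_ideal_addl.
rewrite -e; apply: (submodD hi) => //.
suff [] : (r i `&` P) v by [].
apply: eI; split=> //; have -> : v = z - u by rewrite -e; ring.
by case: hi1 => _ + _; apply=> //; exact: sub.
Qed.

Lemma ideal_chain_map (f : set R -> set R) N M n p :
  (forall P, submod setT P -> N `<=` P -> P `<=` M -> submod setT (f P)) ->
  (forall P Q, submod setT P -> submod setT Q -> N `<=` P -> Q `<=` M -> P `<` Q ->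
     f P `<` f Q) ->
  ideal_chain N M n p -> ideal_chain (f N) (f M) n (f \o p).
Proof.
move=> fI fS ch; have [p0 pn pI pS] := ch; split=> [||i ile|i ilt] /=.
- by rewrite p0.
- by rewrite pn.
- have [? ? ?] := ideal_chain_between ch ile; exact/is_ideal_submod/fI.
- have [? ? _] := ideal_chain_between ch (ltnW ilt).
  have [? _ ?] := ideal_chain_between ch ilt.
  by apply: fS => //; exact: pS.
Qed.

(** The second isomorphism theorem: chains are carried over by adding B and back by intersecting
    with A. *)
Lemma has_length_addI A B n : submod setT A -> submod setT B ->
  has_length (A `&` B) A n -> has_length B (ideal_add A B) n.
Proof.
move=> hA hB [[p hp] pmax].
have hAB := submod_ideal_add hA hB.
split.
  have -> : B = ideal_add (A `&` B) B.
    apply/seteqP; split; first exact/sub_ideal_addr/submodI.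
    by apply: ideal_add_sub => // z [].
  have -> : ideal_add A (ideal_add (A `&` B) B) = ideal_add A B.
    apply/seteqP; split; last by apply: ideal_addS => //; exact/sub_ideal_addr/submodI.
    apply: ideal_add_sub => //; first exact: sub_ideal_addl.
    by apply: ideal_addS => // z [].
  exists ((fun P => ideal_add P B) \o p); apply: (ideal_chain_map _ _ hp).
    by move=> P hP _ _; exact: submod_ideal_add.
  move=> P Q hP hQ IP QA [PQ nQP]; split; first exact: ideal_addS.
  move=> h; apply: nQP => z Qz.
  have [u Pu [v Bv e]] := h z (sub_ideal_addl hB Qz).
  rewrite -e; apply: (submodD hP) => //; apply: IP; split=> //.
  have -> : v = z - u by rewrite -e; ring.
  by case: hA => _ + _; apply; [exact: QA|apply: QA; exact: PQ].
move=> k q hq; apply: (pmax k ((fun P => A `&` P) \o q)).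
have {2}-> : A = A `&` ideal_add A B by apply/esym/setIidl/sub_ideal_addl.
apply: (ideal_chain_map (f := fun P => A `&` P) _ _ hq).
  by move=> P hP _ _; exact: submodI.
move=> P Q hP hQ BP QA [PQ nQP]; split; first exact: setIS.
move=> h; apply: nQP => z Qz.
have [u Au [v Bv e]] := QA z Qz.
rewrite -e; apply: (submodD hP); last exact: BP.
suff [] : (A `&` P) u by [].
apply: h; split=> //; have -> : u = z - v by rewrite -e; ring.
by case: hQ => _ + _; apply=> //; apply/PQ/BP.
Qed.

(** Multiplication by y is injective modulo L: chains are carried over by P to L + yP, and back by
    taking the a in A with y a in the given ideal. *)
Lemma has_length_mul L B A y n : submod setT L -> submod setT B -> submod setT A ->
  L `<=` B -> B `<=` A -> (forall a, L (y * a) -> L a) ->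
  has_length B A n -> has_length (add_mul L y B) (add_mul L y A) n.
Proof.
move=> hL hB hA LB BA yreg [[p hp] pmax]; split.
  exists ((fun P => add_mul L y P) \o p); apply: ideal_chain_map hp => [P hP _ _|].
    exact: submod_add_mul.
  move=> P Q hP hQ BP QA [PQ nQP]; split.
    by move=> _ [u Lu [v Pv <-]]; exists u => //; exists v => //; exact: PQ.
  move=> h; apply: nQP => z Qz.
  have [|u Lu [v Pv e]] := h (y * z).
    by exists 0; [case: hL|exists z => //; rewrite add0r].
  have -> : z = (z - v) + v by ring.
  apply: (submodD hP) => //; apply/BP/LB/yreg.
  by have -> : y * (z - v) = u; [rewrite mulrBr -e; ring|].
move=> k q hq; pose f P := [set a | A a /\ P (y * a)].
have fA : f (add_mul L y A) = A.
  apply/seteqP; split=> [a []//|a Aa]; split=> //.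
  by exists 0; [case: hL|exists a => //; rewrite add0r].
have fB : f (add_mul L y B) = B.
  apply/seteqP; split=> [a [Aa [u Lu [v Bv e]]]|a Ba]; last first.
    split; first exact: BA.
    by exists 0; [case: hL|exists a => //; rewrite add0r].
  have -> : a = (a - v) + v by ring.
  apply: (submodD hB) => //; apply/LB/yreg.
  by have -> : y * (a - v) = u; [rewrite mulrBr -e; ring|].
apply: (pmax k (f \o q)); rewrite -[X in ideal_chain X]fB -[X in ideal_chain _ X]fA.
apply: ideal_chain_map hq => [P [P0 PB PM] _ _|P Q hP hQ BP QA [PQ nQP]].
  have [A0 AB AM] := hA; split=> [|u v [? ?] [? ?]|e u _ [? ?]].
  - by split=> //; rewrite mulr0.
  - by split; [exact: AB|rewrite mulrBr; exact: PB].
  - by split; [exact: AM|rewrite mulrCA; exact: PM].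
split; first by move=> a [Aa /PQ].
have LP : L `<=` P.
  by move=> u Lu; apply: BP; exists u => //; exists 0; [case: hB|rewrite mulr0 addr0].
move=> h; apply: nQP => z Qz; have [u Lu [a Aa e]] := QA z Qz.
rewrite -e; apply: (submodD hP); first exact: LP.
suff [] : f P a by [].
apply: h; split=> //.
have -> : y * a = z - u by rewrite -e; ring.
by case: hQ => _ + _; apply=> //; exact/PQ/LP.
Qed.

Lemma len_has_length (K : realType) M N n : has_length N M n -> len K M N = (n%:R)%:E.
Proof.
move=> [hn nmax]; apply/eqP; rewrite eq_le; apply/andP; split.
  apply: ge_ereal_sup => _ [k [p hp] <-].
  by rewrite lee_fin ler_nat; exact: nmax hp.
by apply: ereal_sup_ubound; exists n.
Qed.

Lemma has_length_len (K : realType) M N r : submod setT N -> submod setT M -> N `<=` M ->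
  len K M N = r%:E -> exists2 n, has_length N M n & r = n%:R.
Proof.
move=> hN hM NM e.
have [|n hn _] := @has_length_bounded N M (Num.truncn r) hN hM NM.
  move=> k p hp; suff : (k%:R : K) <= r.
    move=> kr; rewrite truncn_ge_nat //; apply: le_trans kr; exact: ler0n.
  by rewrite -lee_fin -e; apply: ereal_sup_ubound; exists k => //; exists p.
exists n => //; move: e; rewrite (len_has_length K hn) => -[] //.
Qed.

Definition cofinite A : Prop := submod setT A /\ exists n, has_length A setT n.

(** The default 0 covers infinite colength; the value is meaningful under [cofinite]. *)
Definition colength A : nat := xget 0%N [set n | has_length A setT n].

Lemma colengthE A n : has_length A setT n -> colength A = n.
Proof.
move=> hn; have : exists n, has_length A setT n by exists n.
by move=> /(xgetPex 0%N) h; apply: has_length_uniq h hn.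
Qed.

Lemma has_colength A : cofinite A -> has_length A setT (colength A).
Proof. by move=> [_ [n hn]]; rewrite (colengthE hn). Qed.

(** A chain between ideals containing B extends to one from B to R, so its length is at most that of
    R/B. *)
Lemma cofinite_sub A B : cofinite B -> submod setT A -> B `<=` A ->
  cofinite A /\ exists2 k, has_length B A k & colength B = (k + colength A)%N.
Proof.
move=> [hB [n hn]] hA BA.
have hT : submod setT (setT : set R) by [].
have ex (X Y : set R) : submod setT X -> submod setT Y -> B `<=` X -> X `<=` Y ->
    exists k, has_length X Y k.
  move=> hX hY BX XY; have [|k hk _] := @has_length_bounded X Y n hX hY XY; last by exists k.
  move=> k p hp.
  have [|b [hb1 [q hq] _]] := @ideal_chain_extend B B X 0 _ hX BX.
    by eexists; exact: ideal_chain0.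
  have [r hr] := ideal_chain_cat hq hp.
  have [|b' [hb' [q' hq'] _]] := @ideal_chain_extend B Y setT (b + k) _ hT (@subsetT _ _).
    by exists r.
  have [_ nmax] := hn; have := nmax _ _ hq'; lia.
have [k hk] := ex B A hB hA (@subset_refl _ _) BA.
have [l hl] := ex A setT hA hT BA (@subsetT _ _).
have cA : cofinite A by split=> //; exists l.
split=> //; exists k => //; apply: colengthE.
exact: has_length_add (has_colength cA).
Qed.

End Length.

(** * The Hilbert coefficient *)

Definition hilbert_sum (g : nat -> int) (e n : nat) : int :=
  \sum_(0 <= j < e.+1) (-1) ^+ j * g j * ('C(n + e - j - 1, e - j))%:Z.

(** Pascal's rule in each term, the constant term cancelling: the dimension drops by one and g_0,
    ..., g_e are kept. *)
Lemma hilbert_sum_diff g e n :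
  hilbert_sum g e.+1 n.+1 - hilbert_sum g e.+1 n = hilbert_sum g e n.+1.
Proof.
rewrite /hilbert_sum (big_nat_recr e.+1) //= [X in _ - X](big_nat_recr e.+1) //=.
rewrite !subnn !bin0 opprD addrACA subrr addr0 -sumrB.
apply: eq_big_nat => j /andP[_ je].
have -> : (e.+1 - j = (e - j).+1)%N by lia.
have -> : (n.+1 + e.+1 - j - 1 = (n + e - j).+1)%N by lia.
have -> : (n + e.+1 - j - 1 = n + e - j)%N by lia.
have -> : (n.+1 + e - j - 1 = n + e - j)%N by lia.
by rewrite binS PoszD; ring.
Qed.

Lemma hilbert_sum1 g n : hilbert_sum g 1 n = g 0%N * n%:Z - g 1%N.
Proof.
rewrite /hilbert_sum big_nat_recl // big_nat1 subn0 addn1 subn1 /= bin1 bin0.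
by rewrite expr0 expr1; ring.
Qed.

(** Here k is also the length of A/(A :&: B), and l is the length of (A :&: B)/N. *)
Lemma length_compare (R : comNzRingType) (A B N : set R) :
  submod setT A -> submod setT B -> cofinite N -> N `<=` A -> N `<=` B ->
  exists l k, [/\ has_length B (ideal_add A B) k, has_length N A (l + k)
    & l = 0%N <-> A `&` B `<=` N].
Proof.
move=> hA hB cN NA NB; have hN := cN.1.
have hI := submodI hA hB.
have NI : N `<=` A `&` B by rewrite subsetI.
have [cI [l hl _]] := cofinite_sub cN hI NI.
have IA : A `&` B `<=` A by exact: subIsetl.
have [_ [k hk _]] := cofinite_sub cI hA IA.
exists l, k; split.
- exact: has_length_addI.
- exact: has_length_add hl hk.
split=> [l0|IN].
  by rewrite (has_length_eq0 hN hI NI) -?l0.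
apply: has_length_uniq hl _; have -> : A `&` B = N by exact/seteqP.
exact: has_length_refl.
Qed.

Section Numerics.
Variables (K : realType) (R : comNzRingType) (M : nat -> set R) (y : nat -> R).
Variables (e : nat) (g : nat -> int).
Hypothesis M_submod : forall n, submod setT (M n).
Hypothesis M0 : M 0 = setT.
Hypothesis M_decr : forall n, M n.+1 `<=` M n.
Hypothesis M_mul : forall i n a, (i < e.+1)%N -> M n a -> M n.+1 (y i * a).

Let L i := lin y i setT.
Hypothesis y_regular : forall i a, (i < e.+1)%N -> L i (y i * a) -> L i a.
Hypothesis y_superficial : forall i, (i < e.+1)%N ->
  exists n0, forall n, (n0 <= n)%N -> colon_at M y i n.
Hypothesis M_good : exists n1, forall n, (n1 <= n)%N -> M n.+1 `<=` lin y e.+1 (M n).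
Hypothesis hilb : exists n0, forall n, (n0 <= n)%N ->
  len K setT (M n.+1) = ((hilbert_sum g e.+1 n)%:~R)%:E.

Let hL i : submod setT (L i). Proof. exact: submod_lin. Qed.
Let hML n i : submod setT (ideal_add (M n) (L i)).
Proof. exact: submod_ideal_add. Qed.
Let hlin n : submod setT (lin y e.+1 (M n)). Proof. exact: submod_lin. Qed.

Let cofM n : cofinite (M n).
Proof.
have [n0 h0] := hilb.
have [k hk _] := has_length_len (M_submod _) (M_submod 0) (M_leq M_decr (leq0n _))
  (eq_trans (congr1 (fun S => len K S _) M0) (h0 _ (leq_addr n n0))).
have cM : cofinite (M (n0 + n).+1) by split=> //; exists k; rewrite -M0.
apply: (cofinite_sub cM (M_submod n) _).1.
by apply: (M_leq M_decr); apply: leqW; exact: leq_addl.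
Qed.

Let cofML n i : cofinite (ideal_add (M n) (L i)).
Proof. by apply: (cofinite_sub (cofM n) _ _).1 => //; exact: sub_ideal_addl. Qed.

Let coflin n : cofinite (lin y e.+1 (M n)).
Proof.
have [n1 h1] := M_good.
apply: (cofinite_sub (cofM (n1 + n).+1) (hlin n) _).1.
apply: subset_trans (h1 _ (leq_addr _ _)) _; apply: linS.
by apply: (M_leq M_decr); exact: leq_addl.
Qed.

Let J := L e.+1.
(** Modulo L_e this is y_e M_n in the one-dimensional ring R/L_e. *)
Let W n := add_mul (L e) (y e) (M n).

Let hW n : submod setT (W n). Proof. exact: submod_add_mul. Qed.
Let linW n : lin y e.+1 (M n) `<=` W n.
Proof. by move=> _ [u hu [v hv <-]]; exists u; [exact: linS hu|exists v]. Qed.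
Let cofW n : cofinite (W n).
Proof. exact: (cofinite_sub (coflin n) (hW n) (@linW n)).1. Qed.
Let WJ n : W n `<=` J.
Proof. by move=> _ [u hu [v hv <-]]; exists u => //; exists v. Qed.
Let cofJ : cofinite J.
Proof. exact: (cofinite_sub (cofW 0) (hL _) (@WJ 0)).1. Qed.

Let add_mulML i n : add_mul (L i) (y i) (ideal_add (M n) (L i)) = add_mul (L i) (y i) (M n).
Proof.
apply/seteqP; split=> [_ [u Lu [_ [v Mv [w Lw <-]] <-]]|_ [u Lu [v Mv <-]]].
  exists (u + y i * w).
    by apply: (submodD (hL i)) => //; case: (hL i) => _ _; apply.
  by exists v => //; ring.
by exists u => //; exists v => //; exact: sub_ideal_addl.
Qed.

(** The colon condition makes 0 -> R/(M_n + L_i) -> R/(M_(n+1) + L_i) -> R/(M_(n+1) + L_(i+1)) -> 0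
    exact, the first map being y_i. *)
Lemma colength_quotient i n : (i < e.+1)%N -> colon_at M y i n ->
  colength (ideal_add (M n.+1) (L i)) =
  (colength (ideal_add (M n) (L i)) + colength (ideal_add (M n.+1) (L i.+1)))%N.
Proof.
move=> ie hC.
have BA : ideal_add (M n.+1) (L i) `<=` ideal_add (M n.+1) (L i.+1).
  by apply: ideal_addS => //; exact: lin_leq (leqnSn i).
have [_ [k hk ->]] := cofinite_sub (cofML n.+1 i) (hML n.+1 i.+1) BA.
congr addn; apply: has_length_uniq hk _.
have -> : ideal_add (M n.+1) (L i.+1) = ideal_add (L i.+1) (ideal_add (M n.+1) (L i)).
  apply/seteqP; split.
    apply: ideal_add_sub; first exact: submod_ideal_add.
      apply: subset_trans (@sub_ideal_addl _ _ (L i) (hL i)) _.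
      exact: sub_ideal_addr.
    exact: sub_ideal_addl.
  apply: ideal_add_sub => //; exact: sub_ideal_addr.
apply: has_length_addI => //.
have -> : L i.+1 `&` ideal_add (M n.+1) (L i) =
    add_mul (L i) (y i) (ideal_add (M n) (L i)).
  apply/seteqP; split=> [z [[u Lu [a _ <-]] hz]|_ [u Lu [a ha <-]]].
    exists u => //; exists a => //; apply: hC.
    have -> : y i * a = (u + y i * a) - u by ring.
    by case: (hML n.+1 i) => _ + _; apply=> //; exact: sub_ideal_addr.
  split; first by exists u => //; exists a.
  apply: (submodD (hML _ _)); first exact: sub_ideal_addr.
  exact: (ML_mul M_mul ie).
apply: has_length_mul => //.
- exact: sub_ideal_addr.
- by move=> a; apply: y_regular.
- exact: has_colength.
Qed.

(** Each superficial element replaces the Hilbert polynomial by its difference, down to a linear one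
    for i = e. *)
Lemma colength_hilbert_sum i : (i < e.+1)%N -> exists N, forall n, (N <= n)%N ->
  (colength (ideal_add (M n.+1) (L i)))%:Z = hilbert_sum g (e.+1 - i) n.
Proof.
elim: i => [_|i IH ie].
  have [n0 h0] := hilb; exists n0 => n nn.
  have -> : ideal_add (M n.+1) (L 0) = M n.+1.
    apply/seteqP; split; last exact: sub_ideal_addl.
    by apply: ideal_add_sub => // _ ->; case: (M_submod n.+1).
  have := h0 n nn; rewrite (len_has_length K (has_colength (cofM _))) => -[].
  by rewrite subn0 -[X in X = _ -> _]/((_%:Z)%:~R) => /intr_inj.
have [N hN] := IH (ltnW ie); have [n0 h0] := y_superficial (ltnW ie).
exists (maxn N n0).+1 => -[//|n]; rewrite ltnS geq_max => /andP[Nn n0n].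
have := colength_quotient (ltnW ie) (h0 n.+1 (leqW n0n)).
move=> /(congr1 Posz); rewrite PoszD !hN //; last exact: leqW.
rewrite subSS -(subnSK (ltnW ie : (i < e.+1)%N)) subSS => h.
by rewrite -hilbert_sum_diff h addrAC subrr add0r.
Qed.

Lemma colon_at_length n :
  ideal_add (M n.+1) (L e) `&` J `<=` W n <-> colon_at M y e n.
Proof.
split=> [h a ha|hC z [hz [u Lu [a _ ez]]]].
  have [|u Lu [b Mb eb]] := h (y e * a).
    by split=> //; exists 0; [case: (hL e)|exists a => //; rewrite add0r].
  exists b => //; exists (a - b); last by ring.
  by apply: y_regular => //; have -> : y e * (a - b) = u; [rewrite mulrBr -eb; ring|].
have [|b Mb [l Ll el]] := hC a.
  have -> : y e * a = z - u by rewrite -ez; ring.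
  by case: (hML n.+1 e) => _ + _; apply=> //; exact: sub_ideal_addr.
exists (u + y e * l); first by apply: (submodD (hL e)) => //; case: (hL e) => _ _; apply.
by exists b => //; rewrite -ez -el; ring.
Qed.

(** For z = u + y_e v with v in M_n, the term y_e v lies in both M_(n+1) and J M_n, so only the part
    u in L_e counts. *)
Lemma MW_lin n : M n.+1 `&` W n `<=` lin y e.+1 (M n) <->
  L e `&` M n.+1 `<=` lin y e.+1 (M n).
Proof.
split=> h z [].
  move=> Lz Mz; apply: h; split=> //; exists z => //; exists 0; first by case: (M_submod n).
  by rewrite mulr0 addr0.
move=> Mz [u Lu [v Mv ez]].
have Mu : M n.+1 u.
  have -> : u = z - y e * v by rewrite -ez; ring.
  by case: (M_submod n.+1) => _ + _; apply=> //; exact: M_mul.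
rewrite -ez; apply: (submodD (hlin n)); first exact: h.
exists 0; first by case: (submod_lin y e (M_submod n)).
by exists v => //; rewrite add0r.
Qed.

(** Two uses of [length_compare], above W_n and above J M_n. The equation computes l(R/W_n) through
    M_(n+1) + L_e and through J, where J/W_n is R/(M_n + L_e) via y_e. *)
Lemma length_comparison n : exists avb : nat * nat * nat,
  let: (a, v, b) := avb in
  [/\ has_length J (ideal_add (M n.+1) J) a,
      has_length (lin y e.+1 (M n)) (M n.+1) b,
      (a <= v <= b)%N,
      (v + colength (ideal_add (M n.+1) (L e)) = colength J + colength (ideal_add (M n) (L e)))%N
    & (a = v <-> colon_at M y e n) /\
      (v = b <-> L e `&` M n.+1 `<=` lin y e.+1 (M n))].
Proof.
have WML : W n `<=` ideal_add (M n.+1) (L e).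
  move=> _ [u Lu [v Mv <-]]; exists (y e * v); first exact: M_mul.
  by exists u => //; rewrite addrC.
have [_ [v hv ev]] := cofinite_sub (cofW n) (hML n.+1 e) WML.
have [l [a [ha hlv hl0]]] := length_compare (hML n.+1 e) (hL e.+1) (cofW n) WML (@WJ n).
have [l' [v' [hv' hlb hl0']]] := length_compare (M_submod n.+1) (hW n) (coflin n)
  (lin_M M_submod M_mul (leqnn _)) (@linW n).
(* Adding M_(n+1) to W_n gives M_(n+1) + L_e, so both comparisons share the length v. *)
have ev' : v' = v.
  apply: has_length_uniq hv' _; suff -> : ideal_add (M n.+1) (W n) = ideal_add (M n.+1) (L e) by [].
  apply/seteqP; split; first by apply: ideal_add_sub => //; exact: sub_ideal_addl.
  apply: ideal_addS => // u Lu; exists u => //; exists 0; first by case: (M_submod n).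
  by rewrite mulr0 addr0.
have elv := has_length_uniq hv hlv.
exists (a, v, (l' + v')%N); split=> //.
- have -> // : ideal_add (M n.+1) J = ideal_add (ideal_add (M n.+1) (L e)) J.
  apply/seteqP; split.
    by apply: ideal_addS => //; exact: sub_ideal_addl.
  apply: ideal_add_sub; first exact: (submod_ideal_add (M_submod _) (hL e.+1)).
    apply: ideal_addS => //; exact: (@lin_leq _ y e e.+1 setT _ (leqnSn e)).
  exact: sub_ideal_addr.
- lia.
- rewrite -ev; have [_ [k hk ->]] := cofinite_sub (cofW n) (hL e.+1) (@WJ n).
  rewrite addnC; congr addn; apply: has_length_uniq hk _.
  rewrite /W -add_mulML; apply: has_length_mul => //.
  + exact: sub_ideal_addr.
  + by move=> b; apply: y_regular.
  + exact: has_colength.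
- split; first by rewrite -colon_at_length -hl0; split; lia.
  by rewrite -MW_lin -hl0'; split; lia.
Qed.

(** The sum of v_n for n from 1 to p telescopes to p l(R/J) + l(R/M_1) - l(R/(M_(p+1) + L_e)). For
    large p the last length is g_0 p - g_1, and l(R/J) = g_0. *)
Lemma hilbert_coeff1 : exists (a v b : nat -> nat) (c N : nat),
  [/\ has_length (M 1) setT c,
      forall n, [/\ has_length J (ideal_add (M n.+1) J) (a n),
                    has_length (lin y e.+1 (M n)) (M n.+1) (b n)
                  & (a n <= v n <= b n)%N],
      forall n, (N <= n)%N -> [/\ a n = 0%N, v n = 0%N & b n = 0%N],
      (1 <= N)%N /\ (\sum_(1 <= n < N) v n)%:Z = g 1%N + c%:Z
    & ((forall n, (1 <= n)%N -> a n = v n) <-> forall n, colon_at M y e n) /\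
      ((forall n, (1 <= n)%N -> v n = b n) <-> 
       forall n, L e `&` M n.+1 `<=` lin y e.+1 (M n))].
Proof.
have /choice[avb h] := length_comparison.
pose a n := (avb n).1.1; pose v n := (avb n).1.2; pose b n := (avb n).2.
have {h} h n : [/\ has_length J (ideal_add (M n.+1) J) (a n),
      has_length (lin y e.+1 (M n)) (M n.+1) (b n),
      (a n <= v n <= b n)%N,
      (v n + colength (ideal_add (M n.+1) (L e)) = colength J + colength (ideal_add (M n) (L e)))%N
    & (a n = v n <-> colon_at M y e n) /\
      (v n = b n <-> L e `&` M n.+1 `<=` lin y e.+1 (M n))].
  by have := h n; rewrite /a /v /b; case: (avb n) => -[].
have [n1 h1] := M_good; have [n2 h2] := colength_hilbert_sum (ltnSn e).
(* From p on, M_(n+1) = J M_n and the lengths modulo L_e follow the linear polynomial; N = p + 1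
   allows comparing two of its values. *)
pose p := maxn n1 n2; pose N := p.+1.
have b0 n : (N <= n)%N -> b n = 0%N.
  move=> Nn; have [_ hb _ _ _] := h n; apply: has_length_uniq hb _.
  have -> : M n.+1 = lin y e.+1 (M n); last exact: has_length_refl.
  apply/seteqP; split; last exact: (lin_M M_submod M_mul (leqnn _)).
  apply: h1; rewrite /N /p in Nn; lia.
have v0 n : (N <= n)%N -> v n = 0%N.
  by move=> /b0 bn; have [_ _ + _ _] := h n; lia.
exists a, v, b, (colength (M 1)), N; split.
- exact: has_colength.
- by move=> n; have [? ? ? _ _] := h n.
- move=> n Nn; split; [|exact: v0|exact: b0].
  by have [_ _ + _ _] := h n; rewrite v0 //; lia.
- split=> //.
  have H n : (n2 <= n)%N -> (colength (ideal_add (M n.+1) (L e)))%:Z = g 0%N * n%:Z - g 1%N.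
    by move=> /h2 ->; rewrite subSnn hilbert_sum1.
  (* Since v_N = 0, l(R/J) is the slope of the linear polynomial. *)
  have gJ : (colength J)%:Z = g 0%N.
    have [_ _ _ /(congr1 Posz) + _] := h N; rewrite !PoszD v0 // add0r.
    rewrite H; last by rewrite /N /p; lia.
    rewrite H; last by rewrite /p; lia.
    by move=> E; apply: (@addIr _ (g 0%N * p%:Z - g 1%N)); rewrite -E /N -addn1 PoszD; ring.
  have tele k : (\sum_(1 <= n < k.+1) v n)%:Z + (colength (ideal_add (M k.+1) (L e)))%:Z =
      k%:Z * (colength J)%:Z + (colength (ideal_add (M 1) (L e)))%:Z.
    elim: k => [|k IH]; first by rewrite big_geq // mul0r.
    rewrite big_nat_recr //= PoszD.
    have [_ _ _ /(congr1 Posz) + _] := h k.+1; rewrite !PoszD => hk.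
    rewrite -addrA hk addrCA IH -[k.+1]addn1 PoszD; ring.
  have e1 : ideal_add (M 1) (L e) = M 1.
    apply/seteqP; split; last exact: sub_ideal_addl.
    apply: ideal_add_sub => //; rewrite /L -M0; exact: (lin_M M_submod M_mul (leqnSn e)).
  have := tele p; rewrite gJ e1 H; last by rewrite /p; lia.
  by move=> E; apply: (@addIr _ (g 0%N * p%:Z - g 1%N)); rewrite E; ring.
(* The sums begin at 1; in degree 0 both conditions hold because M_0 is the whole ring. *)
- split; split=> hh n.
  + case: n => [|n]; first by move=> z _; exists z; [rewrite M0|exists 0; [case: (hL e)|rewrite addr0]].
    by have [_ _ _ _ [<- _]] := h n.+1; exact: hh.
  + by move=> _; have [_ _ _ _ [-> _]] := h n.
  + case: n => [|n]; last by have [_ _ _ _ [_ <-]] := h n.+1; exact: hh.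
    by rewrite M0 => z [Lz _]; exact: lin_leq (leqnSn e) _ Lz.
  + by move=> _; have [_ _ _ _ [_ ->]] := h n.
Qed.

End Numerics.

(** * The filtration I1 I2^(n-1) *)

Section IdealProduct.
Variable R : comNzRingType.
Implicit Types A B C I : set R.

Lemma ideal_mul_ideal A B : is_ideal (ideal_mul A B).
Proof. exact: ideal_gen_ideal. Qed.

Lemma submod_ideal_mul A B : submod setT (ideal_mul A B).
Proof. exact/is_ideal_submod/ideal_mul_ideal. Qed.

Lemma ideal_mul_mem A B a b : A a -> B b -> ideal_mul A B (a * b).
Proof. by move=> Aa Bb; apply: sub_ideal_gen; exists a => //; exists b. Qed.

Lemma ideal_mul_sub A B C : submod setT C -> (forall a b, A a -> B b -> C (a * b)) ->
  ideal_mul A B `<=` C.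
Proof.
move=> hC AB; apply: ideal_gen_min; first exact/is_ideal_submod.
by move=> _ [a Aa [b Bb <-]]; exact: AB.
Qed.

Lemma ideal_mulSr A B C : B `<=` C -> ideal_mul A B `<=` ideal_mul A C.
Proof.
move=> BC; apply: ideal_mul_sub; first exact: submod_ideal_mul.
by move=> a b Aa Bb; apply: ideal_mul_mem => //; exact: BC.
Qed.

Lemma ideal_mulT A : submod setT A -> ideal_mul A setT = A.
Proof.
move=> hA; apply/seteqP; split; last first.
  by move=> a Aa; rewrite -[a]mulr1; exact: ideal_mul_mem.
by apply: ideal_mul_sub => // a b Aa _; rewrite mulrC; case: hA => _ _; apply.
Qed.

Lemma ideal_mulCA A B C : ideal_mul A (ideal_mul B C) `<=` ideal_mul B (ideal_mul A C).
Proof.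
apply: ideal_mul_sub; first exact: submod_ideal_mul.
move=> a w Aa; apply: (ideal_gen_min (I := [set w | ideal_mul B (ideal_mul A C) (a * w)])).
  have [I0 ID IM] := ideal_mul_ideal B (ideal_mul A C).
  split=> /= [|u v hu hv|c u hu]; first by rewrite mulr0.
    by rewrite mulrDr; exact: ID.
  by rewrite mulrCA; exact: IM.
move=> _ [b Bb [c Cc <-]] /=; rewrite mulrCA.
by apply: ideal_mul_mem => //; exact: ideal_mul_mem.
Qed.

Lemma submod_ideal_exp I n : submod setT (ideal_exp I n).
Proof. by case: n => // n; exact: submod_ideal_mul. Qed.

Lemma ideal_exp_mem I f n : I f -> ideal_exp I n (f ^+ n).
Proof. by move=> If; elim: n => // n IH; rewrite exprS; exact: ideal_mul_mem. Qed.

Lemma ideal_gen_lin (y : nat -> R) k A :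
  (forall a, A a <-> exists2 j, (j < k)%N & a = y j) -> ideal_gen A = lin y k setT.
Proof.
move=> hA; rewrite -comb_down; apply/seteqP; split.
  apply: ideal_gen_min; first exact/is_ideal_submod/submod_comb.
  by move=> a /hA ?; apply/comb_mem/mem_down.
have : {subset down y k <= [pred a | `[< A a >]]}.
  by move=> a /mem_down/hA ?; exact/asboolP.
have hI := (is_ideal_submod _).1 (ideal_gen_ideal A).
elim: (down y k) => [_ _ ->|a s IH sA _ [u hu [v _ <-]]] /=; first by case: hI.
apply: (submodD hI).
  by apply: IH => // b bs; apply: sA; rewrite in_cons bs orbT.
rewrite mulrC; case: hI => _ _; apply=> //.
have Aa : A a by apply/asboolP; exact: sA (mem_head _ _).
exact: (sub_ideal_gen Aa).
Qed.

Lemma ideal_mul_lin (y : nat -> R) k A : submod setT A ->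
  ideal_mul (lin y k setT) A = lin y k A.
Proof.
move=> hA; have hT : submod setT (setT : set R) by [].
apply/seteqP; split.
  apply: ideal_mul_sub; first exact: submod_lin.
  move=> z a hz Aa; elim: k z hz => [|k IH] z /=; first by move=> ->; rewrite mul0r.
  move=> [u /IH hu [v _ <-]]; exists (u * a) => //; exists (v * a); last by ring.
  by case: hA => _ _; apply.
move=> z; elim: k z => [|k IH] z /=.
  by move=> ->; case: (submod_ideal_mul [set 0] A).
move=> [u /IH hu [v Av <-]]; apply: (submodD (submod_ideal_mul _ _)).
  move: hu; apply: ideal_mul_sub; first exact: submod_ideal_mul.
  by move=> a b ha Ab; apply: ideal_mul_mem => //; exact: (sub_add_mul (y k) hT).
apply: ideal_mul_mem => //; exists 0; first by case: (submod_lin y k hT).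
by exists 1 => //; rewrite mulr1 add0r.
Qed.

Lemma ideal_mul_lin_sub (y : nat -> R) k A B :
  ideal_mul A (lin y k B) `<=` lin y k (ideal_mul A B).
Proof.
apply: ideal_mul_sub; first exact/submod_lin/submod_ideal_mul.
move=> a z Aa; elim: k z => [|k IH] z /=; first by move=> ->; rewrite mulr0.
move=> [u /IH hu [v Bv <-]]; exists (a * u) => //.
by exists (a * v); [exact: ideal_mul_mem|ring].
Qed.

End IdealProduct.

(** * Images in a quotient ring and superficial elements *)

Section Image.
Variables (R S : comNzRingType) (pi : {rmorphism R -> S}).
Hypothesis pi_surj : forall z, exists a, pi a = z.

Lemma image_ideal A : is_ideal A -> is_ideal (pi @` A).
Proof.
move=> [A0 AD AM]; split=> [|_ _ [a Aa <-] [b Ab <-]|c _ [a Aa <-]].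
- by exists 0; rewrite ?rmorph0.
- by exists (a + b); [exact: AD|rewrite rmorphD].
- by have [c' <-] := pi_surj c; exists (c' * a); [exact: AM|rewrite rmorphM].
Qed.

Lemma image_ideal_mul A B : pi @` (ideal_mul A B) = ideal_mul (pi @` A) (pi @` B).
Proof.
apply/seteqP; split; last first.
  apply: ideal_mul_sub; first exact/is_ideal_submod/image_ideal/ideal_mul_ideal.
  move=> _ _ [a Aa <-] [b Bb <-]; exists (a * b); last by rewrite rmorphM.
  exact: ideal_mul_mem.
move=> _ [z hz <-]; move: z hz.
apply: (ideal_gen_min (I := [set z | ideal_mul (pi @` A) (pi @` B) (pi z)])).
  have [I0 ID IM] := ideal_mul_ideal (pi @` A) (pi @` B).
  split=> /= [|u v hu hv|c u hu]; rewrite ?rmorph0 ?rmorphD ?rmorphM //.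
    exact: ID.
  exact: IM.
move=> _ [a Aa [b Bb <-]] /=; rewrite rmorphM.
by apply: ideal_mul_mem; [exists a|exists b].
Qed.

Lemma image_ideal_exp A n : pi @` (ideal_exp A n) = ideal_exp (pi @` A) n.
Proof.
elim: n => [|n IH]; last by rewrite /= image_ideal_mul IH.
by apply/seteqP; split=> // z _; have [a <-] := pi_surj z; exists a.
Qed.

End Image.

(** Superficiality with s = 1 in R/L_i: the image of y_i a lies in the intersection, hence equals
    that of y_i b with b in M_n, and regularity of y_i modulo L_i puts a - b into L_i. *)
Lemma superficial_colon (R : comNzRingType) (d : nat) (x : 'I_d -> R) (y : nat -> R)
    (I1 I2 : set R) (i : 'I_d) :
  (forall j : 'I_d, x j = y j) -> is_ideal I1 -> superficial_seq x I2 I1 ->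
  (forall a, lin y i setT (y i * a) -> lin y i setT a) ->
  exists n0, forall n, (n0 <= n)%N -> colon_at (filtration I1 I2) y i n.
Proof.
move=> xy hI1 [_ /(_ i)[S [pi [[pi_surj pi_ker] [_ [r0 r0_gt0 hs]]]]]] yreg.
have kerE a : pi a = 0 <-> lin y i setT a.
  rewrite pi_ker (ideal_gen_lin (y := y) (k := i)) // => b; split.
    by move=> [j ji <-]; exists j.
  by move=> [j ji ->]; exists (Ordinal (ltn_trans ji (ltn_ord i))); rewrite ?xy.
(* As [r0] is positive, degree 0 is excluded and the member of the filtration has the form I1
   I2^n. *)
exists r0 => -[|n] r0n a [p Mp [l Ll e]]; first by move: r0n; rewrite leqNgt r0_gt0.
have exp1 : ideal_exp (pi @` I1) 1 = pi @` I1.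
  by rewrite /= ideal_mulT //; exact/is_ideal_submod/image_ideal.
have := hs n.+1 1%N r0n; rewrite exp1 -!image_ideal_exp // -!image_ideal_mul // => hE.
have : (ideal_gen [set pi (x i)] `&` pi @` (ideal_mul I1 (ideal_exp I2 n.+1))) (pi (y i * a)).
  split.
    rewrite rmorphM -xy mulrC; case: (ideal_gen_ideal [set pi (x i)]) => _ _; apply.
    exact: sub_ideal_gen.
  by exists p => //; rewrite -e rmorphD (kerE l).2 // addr0.
rewrite hE => hmem.
have [b Mb eb] : exists2 b, ideal_mul I1 (ideal_exp I2 n) b & pi (y i * a) = pi (y i * b).
  move: (pi (y i * a)) hmem.
  have hB := submod_ideal_mul I1 (ideal_exp I2 n).
  apply: ideal_mul_sub => [|u v].
    split.
    - by exists 0; [case: hB|rewrite mulr0 rmorph0].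
    - move=> _ _ [b Bb ->] [b' Bb' ->]; exists (b - b'); last by rewrite mulrBr rmorphB.
      by case: hB => _ + _; apply.
    - move=> c _ _ [b Bb ->]; have [c' <-] := pi_surj c; exists (c' * b).
        by case: hB => _ _; apply.
      by rewrite -rmorphM; congr (pi _); ring.
  move=> hu [b Bb <-].
  have [w ->] : exists w, u = w * pi (x i).
    move: u hu; apply: (ideal_gen_min (I := [set u | exists w, u = w * pi (x i)])).
      split=> /= [|_ _ [w ->] [w' ->]|c _ [w ->]].
      - by exists 0; rewrite mul0r.
      - by exists (w + w'); rewrite mulrDl.
      - by exists (c * w); rewrite mulrA.
    by move=> _ -> /=; exists 1; rewrite mul1r.
  have [w' <-] := pi_surj w; exists (w' * b); first by case: hB => _ _; apply.
  by rewrite -!rmorphM xy; congr (pi _); ring.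
exists b => //; exists (a - b); last by ring.
by apply: yreg; apply/kerE; rewrite mulrBr rmorphB eb subrr.
Qed.

Lemma nneseries_eventually0 (K : realType) (f : nat -> \bar K) (a : nat -> nat) N :
  (1 <= N)%N -> (forall n, (1 <= n)%N -> f n = ((a n)%:R)%:E) ->
  (forall n, (N <= n)%N -> a n = 0%N) ->
  (\sum_(1 <= n <oo) f n)%E = ((\sum_(1 <= n < N) a n)%N%:R)%:E.
Proof.
move=> N1 fa a0; apply: lim_near_cst; first exact: ereal_hausdorff.
exists N => // k /= Nk; rewrite (big_cat_nat N1 Nk) /= [X in (_ + X)%E]big1_seq ?adde0.
  rewrite natr_sum -sumEFin; apply: eq_big_nat => n /andP[n1 _]; exact: fa.
by move=> n /andP[_]; rewrite mem_index_iota => /andP[Nn _]; rewrite fa ?a0 //; lia.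
Qed.

Lemma eq_sum_leq (a b : nat -> nat) N : (forall n, (a n <= b n)%N) ->
  (\sum_(1 <= n < N) a n)%N = (\sum_(1 <= n < N) b n)%N <->
  (forall n, (1 <= n < N)%N -> a n = b n).
Proof.
move=> ab; split=> [e n|e]; last by apply: eq_big_nat.
elim: N e => [_|N IH e nN]; first by lia.
have N1 : (1 <= N)%N by lia.
move: e; rewrite !big_nat_recr //= => e.
have le : (\sum_(1 <= n < N) a n <= \sum_(1 <= n < N) b n)%N by exact: leq_sum.
have abN := ab N.
have [->|nN'] := eqVneq n N; first by lia.
apply: IH; [lia|lia].
Qed.

(** The equality I2^(r+1) = J I2^r propagates to higher powers as an inclusion; the bound is [r.+1]
    because M_n involves I2^(n-1). *)
Lemma reduction_filtration (R : comNzRingType) (y : nat -> R) (d : nat) (I1 I2 : set R) :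
  reduction (lin y d setT) I2 -> exists n1, forall n, (n1 <= n)%N ->
    filtration I1 I2 n.+1 `<=` lin y d (filtration I1 I2 n).
Proof.
move=> [_ _ [r hr]].
have hexp k : ideal_exp I2 (r + k).+1 `<=` ideal_mul (lin y d setT) (ideal_exp I2 (r + k)).
  elim: k => [|k IH]; first by rewrite addn0 hr.
  by rewrite addnS; apply: subset_trans (ideal_mulSr IH) _; exact: ideal_mulCA.
exists r.+1 => -[//|n]; rewrite ltnS => /subnKC <-.
apply: subset_trans (ideal_mulSr (hexp _)) _.
by rewrite ideal_mul_lin; [exact: ideal_mul_lin_sub|exact: submod_ideal_exp].
Qed.

(** If f^k is in I, then f^(k(r+1)) is in I^(r+1) = J I^r, hence in J. *)
Lemma reduction_radical (R : comNzRingType) (J I : set R) f :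
  reduction J I -> radical I f -> exists n, J (f ^+ n).
Proof.
move=> [hJ _ [r hr]] [k Ifk]; exists (k * r.+1)%N; rewrite exprM.
have := ideal_exp_mem r.+1 Ifk; rewrite hr.
apply: ideal_mul_sub; first exact/is_ideal_submod.
by move=> a b Ja _; rewrite mulrC; case: hJ => _ _; apply.
Qed.

(* K is only the field of real numbers in which lengths are measured. *)
Theorem proposition5p6 (K : realType) (R : comNzRingType) (m : set R) (d : nat)
    (I1 I2 : set R) (x : 'I_d -> R) (g : nat -> int)
    (d_ge1 : (1 <= d)%N)
    (R_CM : cohen_macaulay_local m d)
    (residue_inf : infinite_residue_field m)
    (I1_primary : primary_to m I1)
    (I2_primary : primary_to m I2)
    (x_minred : minimal_reduction (ideal_gen (range x)) I2)
    (x_superficial : superficial_seq x I2 I1)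
    (x_I1 : ideal_gen (range x) `<=` I1)
    (g_coeffs : hilbert_coeffs K d I1 I2 g) :
  let J := ideal_gen (range x) in
  let g1 : \bar K := ((g 1%N)%:~R)%:E in
  let lower : \bar K :=
    (\sum_(1 <= n <oo)
        len K (ideal_add (ideal_mul I1 (ideal_exp I2 n)) J) J
     - len K setT I1)%E in
  let upper : \bar K :=
    (\sum_(1 <= n <oo)
        len K (ideal_mul I1 (ideal_exp I2 n))
              (ideal_mul J (ideal_mul I1 (ideal_exp I2 n.-1)))
     - len K setT I1)%E in
  ((lower <= g1)%E /\ (g1 = lower <-> gr_cohen_macaulay x I1 I2)) /\
  ((g1 <= upper)%E /\
    (g1 = upper <-> exists2 k, gr_depth_is x I1 I2 k & (d.-1 <= k)%N)).
Proof.
case: d d_ge1 R_CM x x_minred x_superficial x_I1 g_coeffs => // e _ [noeR loc _ depR].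
move=> x' x_minred' x_superficial' x_I1' g_coeffs' /=.
pose y i := x' (inord i).
have xy (i : 'I_e.+1) : x' i = y i by rewrite /y inord_val.
have JE : ideal_gen (range x') = lin y e.+1 setT.
  apply: ideal_gen_lin => a; split=> [[i _ <-]|[i _ ->]]; last by exists (inord i).
  by exists i.
move: x_minred' x_I1'; rewrite JE => -[red _] JI1.
have [hJ JI2 _] := red.
have [[hI1 I1_1 _] _] := I1_primary; have [[hI2 _ _] I2m] := I2_primary.
have hM n : submod setT (filtration I1 I2 n) by case: n => // n; exact: submod_ideal_mul.
have M1E : filtration I1 I2 1 = I1 by rewrite /= ideal_mulT //; exact/is_ideal_submod.
have yJ i : (i < e.+1)%N -> lin y e.+1 setT (y i).
  by move=> ie; rewrite -comb_down; apply/comb_mem/mem_down; exists i.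
have Mdecr n : filtration I1 I2 n.+1 `<=` filtration I1 I2 n.
  case: n => [|n] //; apply: ideal_mulSr; apply: ideal_mul_sub; first exact: submod_ideal_exp.
  by move=> a b _ hb; case: (submod_ideal_exp I2 n) => _ _; apply.
have Mmul i n a : (i < e.+1)%N -> filtration I1 I2 n a -> filtration I1 I2 n.+1 (y i * a).
  move=> ie; case: n => [_|n ha].
    by rewrite M1E mulrC; case: hI1 => _ _; apply; exact/JI1/yJ.
  have := ideal_mul_mem (JI2 _ (yJ i ie)) ha; exact: ideal_mulCA.
(* Every element of m, the radical of I2, has a power in the reduction J, so depth d makes the
   generators of J a regular sequence. *)
have yreg i a : (i < e.+1)%N -> lin y i setT (y i * a) -> lin y i setT a.
  apply: (depth_regular noeR loc depR) => [j je|f mf].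
    by rewrite -I2m; exists 1%N; rewrite expr1; exact/JI2/yJ.
  by apply: reduction_radical red _; rewrite I2m.
have ysup i : (i < e.+1)%N ->
    exists n0, forall n, (n0 <= n)%N -> colon_at (filtration I1 I2) y i n.
  move=> ie; apply: (superficial_colon (i := Ordinal ie) xy hI1 x_superficial') => a.
  exact: yreg.
have [a [v [b [c [N [hc habv hN [N1 hsum] [av vb]]]]]]] :=
  hilbert_coeff1 (K := K) (g := g) hM erefl Mdecr Mmul yreg ysup
    (reduction_filtration I1 red) g_coeffs'.
have lowE : (\sum_(1 <= n <oo) len K (ideal_add (ideal_mul I1 (ideal_exp I2 n))
    (lin y e.+1 setT)) (lin y e.+1 setT))%E = ((\sum_(1 <= n < N) a n)%N%:R)%:E.
  apply: nneseries_eventually0 => // n hn; last by case: (hN n hn).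
  by apply: len_has_length; case: (habv n).
have upE : (\sum_(1 <= n <oo) len K (ideal_mul I1 (ideal_exp I2 n))
    (ideal_mul (lin y e.+1 setT) (ideal_mul I1 (ideal_exp I2 n.-1))))%E =
    ((\sum_(1 <= n < N) b n)%N%:R)%:E.
  apply: nneseries_eventually0 => // [[//|n] _|n hn]; last by case: (hN n hn).
  rewrite ideal_mul_lin; last exact: submod_ideal_mul.
  by apply: len_has_length; case: (habv n.+1).
have cE : len K setT I1 = (c%:R)%:E by apply: len_has_length; rewrite -M1E.
have g1E : (g 1%N)%:~R = (\sum_(1 <= n < N) v n)%N%:R - c%:R :> K.
  have -> : g 1%N = (\sum_(1 <= n < N) v n)%N%:Z - c%:Z by rewrite hsum; ring.
  by rewrite rmorphB.
have avb n : (a n <= v n)%N /\ (v n <= b n)%N by case: (habv n) => _ _ /andP.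
(* For termwise ordered sequences that agree from N on, equal finite sums force equal terms. *)
have eq_iff (u w : nat -> nat) : (forall n, (u n <= w n)%N) ->
    (forall n, (N <= n)%N -> u n = w n) ->
    (\sum_(1 <= n < N) u n)%N = (\sum_(1 <= n < N) w n)%N <->
    (forall n, (1 <= n)%N -> u n = w n).
  move=> uw hu; rewrite eq_sum_leq //; split=> h n; last by case/andP => + _; exact: h.
  by move=> n1; have [nN|nN] := ltnP n N; [apply: h; rewrite n1|exact: hu].
have [av0 vb0] : (forall n, (N <= n)%N -> a n = v n) /\ (forall n, (N <= n)%N -> v n = b n).
  by split=> n /hN[a0 v0 b0]; rewrite ?a0 v0 ?b0.
have hav := eq_iff a v (fun n => (avb n).1) av0.
have hvb := eq_iff v b (fun n => (avb n).2) vb0.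
rewrite lowE upE cE g1E -!EFinB !lee_fin !lerD2r !ler_nat.
have EFin_eq (p q : nat) : ((p%:R - c%:R : K)%:E = (q%:R - c%:R)%:E) <-> p = q.
  by split=> [[/addIr /eqP]|->] //; rewrite eqr_nat => /eqP.
have M1_1 : ~ filtration I1 I2 1 1 by rewrite M1E.
split; split.
- by apply: leq_sum => n _; case: (avb n).
(* Equality a = v in all degrees is the colon condition for the last element, hence the
   Valabrega-Valla condition for d. *)
- rewrite EFin_eq (gr_cohen_macaulayP xy hM Mdecr Mmul yreg M1_1 ysup).
  rewrite -(valabrega_valla_top hM erefl Mmul yreg ysup (ltn0Sn e)) -av -hav.
  by split=> ->.
- by apply: leq_sum => n _; case: (avb n).
- rewrite EFin_eq (gr_depth_predP xy hM Mdecr Mmul yreg M1_1 ysup (ltn0Sn e)) hvb vb.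
  (* Equality v = b puts L_e :&: M_(n+1) into J M_n, which regularity improves to L_e M_n; the
     converse is monotonicity. *)
  split=> h.
    exact: (valabrega_valla_of_lin hM erefl Mmul yreg (ltnSn e)).
  move=> n z hz; have := h n z hz; exact: lin_leq (hM n) (leqnSn e) _.
Qed.
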